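(* Let the energy $E^{(k)}$ be the pair-interaction energy with potentials $W_{\rm NN}^{(k)},W_{\rm NNN}^{(k)}$ described in the context, satisfying (P1)--(P4), and assume in addition (P5) $\lim_{k\to\infty}k\bar W^{(k)}_{\rm NN}(r_k)=\omega_{\rm NN}$ and $\lim_{k\to\infty}k\bar W^{(k)}_{\rm NNN}(r_k)=\omega_{\rm NNN}$ for any sequence $r_k\to\infty$ (with constants $\omega_{\rm NN},\omega_{\rm NNN}$). Then $$\varphi(u,R)=(\sharp\mathcal L)\,\omega_{\rm NN}+\sharp\{(x',x_*')\in\mathcal L^2:\ |x'-x'_*|=1\}\,\omega_{\rm NNN}$$ for any $0\ne u\in\mathbb R^3$ and $R\in{\rm SO}(3)$, where $\varphi$ is the cell formula defined in the context.
   Context: **Lattice.** $L>0$; $\emptyset\ne S\subset\mathbb R^2$ is a bounded domain, $S=\mathrm{Int}\bigcup_{x'\in\mathcal L'}(x'+[-\frac12,\frac12]^2)$ for a set $\mathcal L'\subset(\frac12+\mathbb Z)^2$; $\mathcal L:=\bar S\cap\mathbb Z^2$; whenever $x'+\{-\frac12,\frac12\}^2\subset\mathcal L$ then $x'\in\mathcal L'$. Set $\mathcal L^{\rm ext}=\mathcal L+\{-1,0,1\}^2$, $\mathcal L'^{,\rm ext}=\mathcal L'+\{-1,0,1\}^2$, $S^{\rm ext}=S+(-1,1)^2$, $L_k=\frac1k\lfloor kL\rfloor$, $\Lambda_k=([0,L]\times\frac1k\bar S)\cap\frac1k\mathbb Z^3$, $\hat\Lambda_k=k\Lambda_k$, $\hat\Lambda_k'=\{\frac12,\dots,kL_k-\frac12\}\times\mathcal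 L'$, $\hat\Lambda_k'^{,\rm surf}=\{\frac12,\dots,kL_k-\frac12\}\times(\mathcal L'^{,\rm ext}\setminus\mathcal L')$, $\hat\Lambda_k'^{,\rm end}=\{-\frac12,kL_k+\frac12\}\times\mathcal L'^{,\rm ext}$. Directions: $z^1=\frac12(-1,-1,-1)^\top$, $z^2=\frac12(-1,-1,1)^\top$, $z^3=\frac12(-1,1,1)^\top$, $z^4=\frac12(-1,1,-1)^\top$, and $z^{i+4}=z^i+e_1$ for $i=1,\dots,4$; $(z^i)'=(z^i_2,z^i_3)$. $\bar{\rm Id}=(z^1|\cdots|z^8)$, $\bar{\rm SO}(3)=\{R\,\bar{\rm Id}:R\in{\rm SO}(3)\}$, ${\rm O}(3)\bar{\rm Id}=\{Q\,\bar{\rm Id}:Q\in{\rm O}(3)\}$. For $\vec y=(\hat y_1|\cdots|\hat y_8)\in\mathbb R^{3\times8}$ put $\bar\nabla\hat y=\vec y-\frac18(\sum_j\hat y_j)(1,\dots,1)$. **Pair-interaction energy.** For $y\colon\Lambda_k\to\mathbb R^3$, $\hat y(\hat x)=ky(\frac1k\hat x)$, $$E^{(k)}(y)=\frac12\sum_{\hat x_*,\hat x_{**}\in\hat\Lambda_k,\,|\hat x_*-\hat x_{**}|=1}W_{\rm NN}^{(k)}(|\hat y(\hat x_* )-\hat y(\hat x_{**})|)+\frac12\sum_{\hat x_*,\hat x_{**}\in\hat\Lambda_k,\,|\hat x_*-\hat x_{**}|=\sqrt2}W_{\rm NNN}^{(k)}\Bigl(\frac{|\hat y(\hat x_* )-\hat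 y(\hat x_{**})|}{\sqrt2}\Bigr)+\mathcal X_k(y),$$ where $\mathcal X_k\ge0$ is a term included to guarantee preservation of orientation; it gives rise to the term $\chi^{(k)}$ below. With NN(N) meaning each of NN and NNN: (P1) $W_{\rm NN(N)}^{(k)}\colon[0,\infty)\to[0,\infty]$ is continuous and finite on $(0,\infty)$, and $W_{\rm NN(N)}^{(k)}(r)=0$ iff $r=1$. (P2) There are $c_{\rm f}^{(k)}\searrow0$ with $\lim_kk[c_{\rm f}^{(k)}]^2\in(0,\infty)$ such that $W_{\rm NN(N)}^{(k)}(r)=W_{\rm 0NN(N)}(r)$ for $r\in(1-c_{\rm f}^{(k)},1+c_{\rm f}^{(k)})$, where $W_{\rm 0NN(N)}$ is $C^2$ and $W_{\rm 0NN(N)}''(1)>0$. (P3) $W_{\rm NN(N)}^{(k)}(r)=\bar W_{\rm NN(N)}^{(k)}(r)$ if $r\in[0,1-c_{\rm f}^{(k)}]\cup[1+c_{\rm f}^{(k)},\infty)$, where $\bar W_{\rm NN(N)}^{(k)}$ is bounded below by $\bar c_{\rm NN(N)}^{(k)}$ with $k\bar c_{\rm NN(N)}^{(k)}\to\bar c_{\rm NN(N)}>0$; and $(k+1)W_{\rm NN(N)}^{(k+1)}\ge kW_{\rm NN(N)}^{(k)}$ for all $k$. (P4) $\bar W_{\rm NN(N)}^{(k)}(r)=\omega_{\rm NN(N)}^{(k)}+\frac1k\rho_{\rm NN(N)}(r)$ if $r\ge k\bar M_k$, for some $\bar M_k\to0$ with $k\bar M_k\to\infty$, where $\rho_{\rm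 NN(N)}(r)=O(r^{-1})$ as $r\to\infty$ and $\lim_kk\omega_{\rm NN(N)}^{(k)}\in(0,\infty)$. **Cell energies.** The energy is written as a sum of cell energies: with $\vec y(\hat x)=(\hat y(\hat x+z^1)|\cdots|\hat y(\hat x+z^8))$ (for $y$ extended to $\{-\frac1k,0,\dots,L_k+\frac1k\}\times\frac1k\mathcal L^{\rm ext}$), $$E^{(k)}(y)=\sum_{\hat x\in\hat\Lambda_k'}W^{(k)}_{\rm cell}(\vec y(\hat x))+\sum_{\hat x\in\hat\Lambda_k'^{,\rm surf}}W^{(k)}_{\rm surf}(\hat x',\vec y(\hat x))+\sum_{\hat x\in\hat\Lambda_k'^{,\rm end}}W^{(k)}_{\rm end}(\tfrac1k\hat x_1,\hat x',\vec y(\hat x)),$$ where, for $\vec y=(\hat y_1|\cdots|\hat y_8)\in\mathbb R^{3\times8}$ (sums over ordered pairs $(i,j)$), $$W^{(k)}_{\rm cell}(\vec y)=\frac18\sum_{|z^i-z^j|=1}W_{\rm NN}^{(k)}(|\hat y_i-\hat y_j|)+\frac14\sum_{|z^i-z^j|=\sqrt2}W_{\rm NNN}^{(k)}\Bigl(\frac{|\hat y_i-\hat y_j|}{\sqrt2}\Bigr)+\chi^{(k)}(\vec y),$$ and $W_{\rm surf}^{(k)}$, $W_{\rm end}^{(k)}$ are constructed in a similar manner to account for the surface contributions to atomic bonds lying on the rod's boundary. The frame-indifferent term $\chi^{(k)}$, $C/k\ge\chi^{(k)}\ge0$, penalizes deformations that are not locally orientation-preserving, i.e. it is greater than or equal to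 $\bar c/k$, $\bar c>0$, on a $k$-independent neighbourhood of ${\rm O}(3)\bar{\rm Id}\setminus\bar{\rm SO}(3)$ and vanishes otherwise. $W^{(k)}_{\rm tot}(x',\cdot)=W^{(k)}_{\rm cell}$ for $x'\in\mathcal L'$ and $=W^{(k)}_{\rm surf}(x',\cdot)$ for $x'\in\mathcal L'^{,\rm ext}\setminus\mathcal L'$. **Standing assumptions on the cell energies** ($\mathscr W^{(k)}$ stands for any of $W^{(k)}_{\rm cell}$, $W^{(k)}_{\rm surf}(\hat x',\cdot)$, $W^{(k)}_{\rm end}(\frac1k\hat x_1,\hat x',\cdot)$, all $[0,\infty]$-valued). (W1) $\mathscr W^{(k)}(R\vec y+(c|\cdots|c))=\mathscr W^{(k)}(\vec y)$ for $R\in{\rm SO}(3)$, $c\in\mathbb R^3$. (W2) $\mathscr W^{(k)}$ attains its minimum, equal to $0$, at $\vec y$ with $\hat y_i=Rz^i+c$, $R\in{\rm SO}(3)$, $c\in\mathbb R^3$. (W3) There are $c^{(k)}_{\rm frac}\searrow0$ with $\lim_kk(c^{(k)}_{\rm frac})^2\in(0,\infty)$ and $W_0\colon\mathcal L'^{,\rm ext}\times\mathbb R^{3\times8}\to[0,\infty]$ with $W^{(k)}_{\rm tot}(x',\vec y)=W_0(x',\vec y)$ whenever $\mathrm{dist}(\bar\nabla\hat y,\bar{\rm SO}(3))\le c^{(k)}_{\rm frac}$; and for such $\vec y$, $W_{\rm end}^{(k)}(\cdot,\cdot,\vec y)\le C\,\mathrm{dist}^2(\bar\nabla\hat y,\bar{\rm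 SO}(3))$ with $C$ independent of $k$. (W4) $W^{(k+1)}_{\rm tot}(x',\vec y)\ge\frac k{k+1}W^{(k)}_{\rm tot}(x',\vec y)$ for all $k,x',\vec y$. (W5) On $\mathcal L'$, $W_0$ does not depend on $x'$ and $W_0(\vec y)\ge c_{\rm W}\mathrm{dist}^2(\bar\nabla\hat y,\bar{\rm SO}(3))$ for all $\vec y$, with $c_{\rm W}>0$; and $W^{(k)}_{\rm cell}(\vec y)\ge\bar c_1^{(k)}$ whenever $\mathrm{dist}(\bar\nabla\hat y,\bar{\rm SO}(3))>c^{(k)}_{\rm frac}$, where $\bar c_1^{(k)}>0$ and $\lim_kk\bar c_1^{(k)}\in(0,\infty)$. (W6) $\mathscr W^{(k)}$ is Borel, and $W_0(x',\cdot)$ is $C^2$ near $\bar{\rm SO}(3)$ for each $x'\in\mathcal L'^{,\rm ext}$. (W7) $W^{(k)}_{\rm surf}(\hat x',\vec y)$ may depend on $\hat y_i$ only if $\hat x'+(z^i)'\in\mathcal L$; $W_{\rm end}^{(k)}(x_1,\hat x',\vec y)$ may depend on $\hat y_i$ only if $(x_1+\frac1kz^i_1,\hat x'+(z^i)')\in\{0,\frac1k,\dots,L_k\}\times\mathcal L$. **Cell formula.** For $r>0$, $k\in\mathbb N$ put $h=\frac1{rk}$, $\Lambda_{r,k}=(h\mathbb Z\cap(-1-h,1+h))\times\mathcal L^{\rm ext}$, $\Lambda'_{r,k}=((\frac h2+h\mathbb Z)\cap(-1-\frac h2,1+\frac h2))\times\mathcal L'^{,\rm ext}$. ${\rm PAff}(\Lambda_{r,k})$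 is the set of $\mathbb R^3$-valued piecewise affine maps obtained from arbitrary values on $\Lambda_{r,k}$ as follows: on each block $(w_1,x')+[-\frac h2,\frac h2]\times[-\frac12,\frac12]^2$ with corners in $\Lambda_{r,k}$ and $x'\in\mathcal L'^{,\rm ext}$, the value at the centre is the average of the 8 corner values, the value at the centre of each face is the average of its 4 corner values, and the map is affine on each of the 24 simplices spanned by the block centre, a face centre and two adjacent corners of that face. For $v\in{\rm PAff}(\Lambda_{r,k})$, $\vec v(w_1,x')=k\bigl(v(w_1+hz_1^i,x'+(z^i)')\bigr)_{i=1}^8$. Let $I^-=[-1,-\frac34]$, $I^+=[\frac34,1]$. For $y^\pm\in\mathbb R^3$, $R^\pm\in{\rm SO}(3)$ let $\mathcal V_{y^+-y^-,(R^-)^{-1}R^+}$ be the set of triples $((r_n)_n,(k_n)_n,(v_n)_n)$ with $r_n>0$, $k_n\in\mathbb N$, $v_n\in{\rm PAff}(\Lambda_{r_n,k_n})$, $r_n\searrow0$, $r_nk_n\to\infty$, and $v_n(w_1,x')=R_\pm^{n}(r_nw_1,\frac1{k_n}x')^\top+y_\pm^n$ on $I^\pm\times\overline{S^{\rm ext}}$ for some $R^n_\pm\in{\rm SO}(3)$, $y^n_\pm\in\mathbb R^3$ with $R_\pm^n\to R^\pm$, $y_\pm^n\to y^\pm$. The function $\varphi\colon\mathbb R^3\times{\rm SO}(3)\to[0,\infty]$ is given by $$\varphi\bigl(y^+-y^-,(R^-)^{-1}R^+\bigr)=\min\Bigl\{\limsup_{n\to\infty}\sum_{(w_1,x')\in\Lambda'_{r_n,k_n}}k_nW^{(k_n)}_{\rm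 tot}(x',\vec v_n(w_1,x'))\;:\;((r_n)_n,(k_n)_n,(v_n)_n)\in\mathcal V_{y^+-y^-,(R^-)^{-1}R^+}\Bigr\}.$$
   Formalization: The k-independent neighbourhood of O(3)Id∖SO(3)Id on which χ^(k) acts is taken for the discrete gradient and assumed bounded; with an unbounded neighbourhood χ^(k) may also charge completely torn cells and the formula fails. *)

(* Defs.v *)
From HB Require Import structures.
From mathcomp Require Export all_boot all_order all_algebra.
From mathcomp Require Export all_classical all_reals all_analysis.
From mathcomp Require Export measurable_realfun finmap.

Set Implicit Arguments.
Unset Strict Implicit.
Unset Printing Implicit Defensive.

Export Order.TTheory GRing.Theory Num.Theory.
Export numFieldNormedType.Exports.

Local Open Scope classical_set_scope.
Local Open Scope ring_scope.

(* The library norm on matrices is the sup norm, hence this Euclidean one. *)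
Definition enorm (R : realType) (m n : nat) (A : 'M[R]_(m, n)) : R :=
  Num.sqrt (\sum_i \sum_j A i j ^+ 2).

Definition O3 (R : realType) : set 'M[R]_3 := [set Q | Q^T *m Q = 1%:M].

Definition SO3 (R : realType) : set 'M[R]_3 := [set Q | O3 Q /\ \det Q = 1].

Definition pt (R : realType) (a : R) (x' : 'cV[R]_2) : 'cV[R]_3 :=
  col_mx (a%:M : 'cV[R]_1) x'.

Definition Idbar (R : realType) : 'M[R]_(3, 8) :=
  \matrix_(a, i) (nth 0 (nth [::] ([::
    [:: -1; -1; -1; -1;  1;  1;  1;  1];
    [:: -1; -1;  1;  1; -1; -1;  1;  1];
    [:: -1;  1;  1; -1; -1;  1;  1; -1]] : seq (seq R)) a) i / 2).

Definition z (R : realType) (i : 'I_8) : 'cV[R]_3 := col i (Idbar R).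
Definition z1 (R : realType) (i : 'I_8) : R := z R i 0 0.
Definition z' (R : realType) (i : 'I_8) : 'cV[R]_2 :=
  dsubmx (z R i : 'cV[R]_(1 + 2)).

Definition SObar (R : realType) : set 'M[R]_(3, 8) :=
  [set Q *m Idbar R | Q in @SO3 R].
Definition Obar (R : realType) : set 'M[R]_(3, 8) :=
  [set Q *m Idbar R | Q in @O3 R].

Definition bgrad (R : realType) (y : 'M[R]_(3, 8)) : 'M[R]_(3, 8) :=
  \matrix_(a, i) (y a i - 8^-1 * \sum_j y a j).

Definition edist (R : realType) (m n : nat) (A : 'M[R]_(m, n))
    (B : set 'M[R]_(m, n)) : R :=
  inf [set enorm (A - X) | X in B].

Definition rigid_image (R : realType) (Q : 'M[R]_3) (c : 'cV[R]_3)
    (y : 'M[R]_(3, 8)) : 'M[R]_(3, 8) :=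
  Q *m y + \matrix_(a, i) c a 0.

Definition msum (V : zmodType) (A B : set V) : set V :=
  [set x + y | x in A & y in B].

Definition integer_points (R : realType) : set 'cV[R]_2 :=
  [set x | forall a, x a 0 \is a Num.int].
Definition half_integer_points (R : realType) : set 'cV[R]_2 :=
  [set x | forall a, x a 0 - 2^-1 \is a Num.int].
Definition neighbour_shifts (R : realType) : set 'cV[R]_2 :=
  [set d | forall a, d a 0 \in [:: -1; 0; 1]].
Definition corner_shifts (R : realType) : set 'cV[R]_2 :=
  [set d | forall a, d a 0 \in [:: - 2^-1; 2^-1]].
Definition unit_square (R : realType) (x' : 'cV[R]_2) : set 'cV[R]_2 :=
  [set x | forall a, `|x a 0 - x' a 0| <= 2^-1].
Definition open_square (R : realType) : set 'cV[R]_2 :=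
  [set d | forall a, `|d a 0| < 1].

Definition lattice (R : realType) (S : set 'cV[R]_2) : set 'cV[R]_2 :=
  closure S `&` @integer_points R.

Definition lext (R : realType) (A : set 'cV[R]_2) : set 'cV[R]_2 :=
  msum A (@neighbour_shifts R).

Definition Sext (R : realType) (S : set 'cV[R]_2) : set 'cV[R]_2 :=
  msum S (@open_square R).

(* [L'] is the set of centres of the unit cells of the cross-section [S]. *)
Record cross_section (R : realType) (S L' : set 'cV[R]_2) : Prop := {
  cs_nonempty : S !=set0;
  cs_open : open S;
  cs_connected : connected S;
  cs_bounded : bounded_set S;
  cs_centres : L' `<=` @half_integer_points R;
  cs_cells : S = interior (\bigcup_(x' in L') unit_square x');
  cs_full : forall x', msum [set x'] (@corner_shifts R) `<=` lattice S -> L' x'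
}.

(* In every sequence indexed by [k] only the indices [k >= 1] matter. *)

(* In finite dimension, continuity of all second directional derivatives on an
   open set [A] amounts to [f] being C^2 on [A]. *)
Definition C2_on (R : realType) (V : normedModType R) (A : set V) (f : V -> R) :=
  forall x, A x -> forall v w : V,
    [/\ derivable f x v, derivable ('D_v f) x w
      & {for x, continuous ('D_w ('D_v f))}].

Definition threshold (R : realType) (c : nat -> R) : Prop :=
  [/\ forall k, (0 < k)%N -> c k.+1 <= c k,
      c k @[k \oo] --> (0 : R)
    & exists2 l : R, 0 < l & k%:R * c k ^+ 2 @[k \oo] --> l].

Record pair_potential (R : realType) (cf : nat -> R)
    (W Wbar : nat -> R -> \bar R) (W0 : R -> R) : Prop := {
  pp_ge0 : forall (k : nat) (r : R), (0 < k)%N -> 0 <= r -> (0 <= W k r)%E;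
  pp_fin : forall (k : nat) (r : R), (0 < k)%N -> 0 < r -> W k r \is a fin_num;
  pp_cont : forall (k : nat) (r : R), (0 < k)%N -> 0 < r -> {for r, continuous (W k)};
  pp_eq0 : forall (k : nat) (r : R), (0 < k)%N -> 0 <= r -> (W k r = 0%E <-> r = 1);
  pp_near : forall (k : nat) (r : R), (0 < k)%N -> 0 <= r -> 1 - cf k < r < 1 + cf k ->
    W k r = (W0 r)%:E;
  pp_C2 : C2_on [set r : R | 1 - cf 1%N < r < 1 + cf 1%N] W0;
  pp_convex : 0 < W0^`(2)%classic 1;
  pp_far : forall (k : nat) (r : R), (0 < k)%N -> 0 <= r -> r <= 1 - cf k \/ 1 + cf k <= r ->
    W k r = Wbar k r;
  pp_lbound : exists cbar : nat -> R,
    (exists2 l : R, 0 < l & k%:R * cbar k @[k \oo] --> l) /\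
    (forall (k : nat) (r : R), (0 < k)%N -> 0 <= r -> ((cbar k)%:E <= Wbar k r)%E);
  pp_mono : forall (k : nat) (r : R), (0 < k)%N -> 0 <= r ->
    (k%:R%:E * W k r <= k.+1%:R%:E * W k.+1 r)%E;
  pp_tail : exists (omega M : nat -> R) (rho : R -> R),
    [/\ M k @[k \oo] --> (0 : R),
        k%:R * M k @[k \oo] --> +oo,
        (exists C : R, \forall r \near +oo, `|rho r| <= C * r^-1),
        (exists2 l : R, 0 < l & k%:R * omega k @[k \oo] --> l)
      & forall (k : nat) (r : R), (0 < k)%N -> 0 <= r -> k%:R * M k <= r ->
          Wbar k r = (omega k + k%:R^-1 * rho r)%:E]
}.

Definition far_limit (R : realType) (Wbar : nat -> R -> \bar R) (omega : R) :=
  forall r : nat -> R, r k @[k \oo] --> +oo ->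
    (k%:R%:E * Wbar k (r k))%E @[k \oo] --> omega%:E.

(* Since [chi k] is translation invariant, its neighbourhood [N] of
   O(3) Id \ SO(3) Id is a neighbourhood for the discrete gradient. It has to be
   bounded: otherwise [chi] could also charge completely broken cells. *)
Record orientation_penalty (R : realType) (chi : nat -> 'M[R]_(3, 8) -> R)
    : Prop := {
  op_frame : forall k Q c y, (0 < k)%N -> SO3 Q ->
    chi k (rigid_image Q c y) = chi k y;
  op_bounds : exists C : R, forall k y, (0 < k)%N ->
    0 <= chi k y <= C / k%:R;
  op_support : exists (N : set 'M[R]_(3, 8)) (cbar : R),
    [/\ 0 < cbar, bounded_set N, @Obar R `\` @SObar R `<=` interior N
      & forall k y, (0 < k)%N ->
          (N (bgrad y) -> cbar / k%:R <= chi k y) /\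
          (~ N (bgrad y) -> chi k y = 0)]
}.

Definition bonds (R : realType) (A : set 'I_8) (d : R) : pred ('I_8 * 'I_8) :=
  fun p => [&& p.1 \in A, p.2 \in A & enorm (z R p.1 - z R p.2) == d].

Definition bond_length (R : realType) (y : 'M[R]_(3, 8)) (p : 'I_8 * 'I_8) : R :=
  enorm (col p.1 y - col p.2 y).

(* An edge of the cubic lattice belongs to four cells and a face diagonal to two;
   the remaining factor 1/2 is due to the summation over ordered pairs. *)
Definition bond_energy (R : realType) (WNN WNNN : nat -> R -> \bar R) (k : nat)
    (A : set 'I_8) (y : 'M[R]_(3, 8)) : \bar R :=
  ((8^-1)%:E * (\sum_(p | bonds A (1 : R) p) WNN k (bond_length y p))
   + (4^-1)%:E * (\sum_(p | bonds A (Num.sqrt 2 : R) p)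
                    WNNN k (bond_length y p / Num.sqrt 2)%R))%E.

Definition Wcell (R : realType) (WNN WNNN : nat -> R -> \bar R)
    (chi : nat -> 'M[R]_(3, 8) -> R) (k : nat) (y : 'M[R]_(3, 8)) : \bar R :=
  (bond_energy WNN WNNN k setT y + (chi k y)%:E)%E.

Definition surf_sites (R : realType) (S : set 'cV[R]_2) (x' : 'cV[R]_2)
    : set 'I_8 :=
  [set i | lattice S (x' + z' R i)].

Definition Wsurf (R : realType) (S : set 'cV[R]_2)
    (WNN WNNN : nat -> R -> \bar R) (k : nat) (x' : 'cV[R]_2)
    (y : 'M[R]_(3, 8)) : \bar R :=
  bond_energy WNN WNNN k (surf_sites S x') y.

(* {0, 1/k, ..., L_k} with L_k = floor (k L) / k *)
Definition axial_sites (R : realType) (L : R) (k : nat) : set R :=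
  [set t | exists m : nat,
     m%:Z <= Num.floor (k%:R * L) /\ t = m%:R / k%:R].

Definition end_sites (R : realType) (L : R) (S : set 'cV[R]_2) (k : nat) (x1 : R)
    (x' : 'cV[R]_2) : set 'I_8 :=
  [set i | axial_sites L k (x1 + k%:R^-1 * z1 R i) /\ lattice S (x' + z' R i)].

Definition Wend (R : realType) (L : R) (S : set 'cV[R]_2)
    (WNN WNNN : nat -> R -> \bar R) (k : nat) (x1 : R) (x' : 'cV[R]_2)
    (y : 'M[R]_(3, 8)) : \bar R :=
  bond_energy WNN WNNN k (end_sites L S k x1 x') y.

Definition Wtot (R : realType) (L' : set 'cV[R]_2)
    (Wc : nat -> 'M[R]_(3, 8) -> \bar R)
    (Ws : nat -> 'cV[R]_2 -> 'M[R]_(3, 8) -> \bar R)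
    (k : nat) (x' : 'cV[R]_2) (y : 'M[R]_(3, 8)) : \bar R :=
  if x' \in L' then Wc k y else Ws k x' y.

(* {- 1/(2k), L_k + 1/(2k)}, the axial coordinates of the end cells *)
Definition end_coords (R : realType) (L : R) (k : nat) : set R :=
  [set - 2^-1 / k%:R; ((Num.floor (k%:R * L))%:~R + 2^-1) / k%:R].

Definition cell_energies (R : realType) (L : R) (L' : set 'cV[R]_2)
    (Wc : nat -> 'M[R]_(3, 8) -> \bar R)
    (Ws : nat -> 'cV[R]_2 -> 'M[R]_(3, 8) -> \bar R)
    (We : nat -> R -> 'cV[R]_2 -> 'M[R]_(3, 8) -> \bar R)
    (k : nat) : set ('M[R]_(3, 8) -> \bar R) :=
  [set W | [\/ W = Wc k,
               exists2 x', (lext L' `\` L') x' & W = Ws k x'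
             | exists x1 x', [/\ end_coords L k x1, lext L' x'
                               & W = We k x1 x']]].

Definition depends_only_on (R : realType) (A : set 'I_8)
    (W : 'M[R]_(3, 8) -> \bar R) : Prop :=
  forall y1 y2 : 'M[R]_(3, 8),
    (forall i, A i -> col i y1 = col i y2) -> W y1 = W y2.

Record standing_assumptions (R : realType) (L : R) (S L' : set 'cV[R]_2)
    (Wc : nat -> 'M[R]_(3, 8) -> \bar R)
    (Ws : nat -> 'cV[R]_2 -> 'M[R]_(3, 8) -> \bar R)
    (We : nat -> R -> 'cV[R]_2 -> 'M[R]_(3, 8) -> \bar R)
    (cfrac : nat -> R) (W0 : 'cV[R]_2 -> 'M[R]_(3, 8) -> \bar R) : Prop := {
  sa_frame : forall k W, (0 < k)%N -> cell_energies L L' Wc Ws We k W ->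
    forall Q c y, SO3 Q -> W (rigid_image Q c y) = W y;
  sa_ge0 : forall k W, (0 < k)%N -> cell_energies L L' Wc Ws We k W ->
    forall y, (0 <= W y)%E;
  sa_min : forall k W, (0 < k)%N -> cell_energies L L' Wc Ws We k W ->
    forall Q c, SO3 Q -> W (rigid_image Q c (Idbar R)) = 0%E;
  sa_threshold : threshold cfrac;
  sa_W0_ge0 : forall x' y, lext L' x' -> (0 <= W0 x' y)%E;
  sa_near : forall k x' y, (0 < k)%N -> lext L' x' ->
    edist (bgrad y) (@SObar R) <= cfrac k ->
    Wtot L' Wc Ws k x' y = W0 x' y;
  sa_end : exists C : R, forall k x1 x' y, (0 < k)%N ->
    end_coords L k x1 -> lext L' x' ->
    edist (bgrad y) (@SObar R) <= cfrac k ->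
    (We k x1 x' y <= (C * edist (bgrad y) (@SObar R) ^+ 2)%:E)%E;
  sa_mono : forall k x' y, (0 < k)%N -> lext L' x' ->
    ((k%:R / k.+1%:R)%:E * Wtot L' Wc Ws k x' y
       <= Wtot L' Wc Ws k.+1 x' y)%E;
  sa_W0_bulk : forall x1' x2' y, L' x1' -> L' x2' -> W0 x1' y = W0 x2' y;
  sa_W0_lbound : exists2 cW : R, 0 < cW & forall x' y, L' x' ->
    ((cW * edist (bgrad y) (@SObar R) ^+ 2)%:E <= W0 x' y)%E;
  sa_far : exists c1 : nat -> R,
    [/\ forall k, (0 < k)%N -> 0 < c1 k,
        exists2 l : R, 0 < l & k%:R * c1 k @[k \oo] --> l
      & forall k y, (0 < k)%N -> cfrac k < edist (bgrad y) (@SObar R) ->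
          ((c1 k)%:E <= Wc k y)%E];
  sa_borel : forall k W, (0 < k)%N -> cell_energies L L' Wc Ws We k W ->
    measurable_fun [set: g_sigma_algebraType (@open 'M[R]_(3, 8))] W;
  sa_C2 : forall x', lext L' x' -> exists U : set 'M[R]_(3, 8),
    [/\ open U, @SObar R `<=` U, forall y, U y -> W0 x' y \is a fin_num
      & C2_on U (fun y => fine (W0 x' y))];
  sa_surf_sites : forall k x', (0 < k)%N -> (lext L' `\` L') x' ->
    depends_only_on (surf_sites S x') (Ws k x');
  sa_end_sites : forall k x1 x', (0 < k)%N -> end_coords L k x1 ->
    lext L' x' -> depends_only_on (end_sites L S k x1 x') (We k x1 x')
}.

Definition mesh (R : realType) (r : R) (k : nat) : R := (r * k%:R)^-1.

Definition Lambda (R : realType) (S : set 'cV[R]_2) (r : R) (k : nat)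
    : set (R * 'cV[R]_2) :=
  let h := mesh r k in
  [set x | [/\ exists m : int, x.1 = m%:~R * h, - 1 - h < x.1 < 1 + h
             & lext (lattice S) x.2]].

Definition Lambda' (R : realType) (L' : set 'cV[R]_2) (r : R) (k : nat)
    : set (R * 'cV[R]_2) :=
  let h := mesh r k in
  [set x | [/\ exists m : int, x.1 = h / 2 + m%:~R * h,
               - 1 - h / 2 < x.1 < 1 + h / 2
             & lext L' x.2]].

Definition corner (R : realType) (h w : R) (x' : 'cV[R]_2) (i : 'I_8)
    : R * 'cV[R]_2 :=
  (w + h * z1 R i, x' + z' R i).

Definition affine_on_simplex (R : realType) (v : 'cV[R]_3 -> 'cV[R]_3)
    (p : 'I_4 -> 'cV[R]_3) : Prop :=
  forall t : 'I_4 -> R, (forall j, 0 <= t j) -> \sum_j t j = 1 ->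
    v (\sum_j t j *: p j) = \sum_j t j *: v (p j).

(* The face of a block through corner [i] orthogonal to [e_a] has the corners
   [j] with [Idbar a j = Idbar a i]. Only the values of [v] on the union of the
   blocks are constrained. *)
Definition PAff (R : realType) (S L' : set 'cV[R]_2) (r : R) (k : nat)
    (v : 'cV[R]_3 -> 'cV[R]_3) : Prop :=
  forall (w : R) (x' : 'cV[R]_2),
    let q i := corner (mesh r k) w x' i in
    let p i := pt (q i).1 (q i).2 in
    let face a i := fun j => Idbar R a j == Idbar R a i in
    let face_centre a i := 4^-1 *: \sum_(j | face a i j) p j in
    lext L' x' -> (forall i, Lambda S r k (q i)) ->
    [/\ v (pt w x') = 8^-1 *: \sum_i v (p i),
        forall a i, v (face_centre a i) = 4^-1 *: \sum_(j | face a i j) v (p j)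
      & forall a i j, face a i j -> enorm (z R i - z R j) = 1 ->
          affine_on_simplex v
            (tnth [tuple pt w x'; face_centre a i; p i; p j])].

Definition cell_values (R : realType) (r : R) (k : nat)
    (v : 'cV[R]_3 -> 'cV[R]_3) (x : R * 'cV[R]_2) : 'M[R]_(3, 8) :=
  \matrix_(a, i)
    (k%:R * v (pt (corner (mesh r k) x.1 x.2 i).1
                  (corner (mesh r k) x.1 x.2 i).2) a 0).

Definition rigid_on (R : realType) (S : set 'cV[R]_2) (I : set R) (r : R)
    (k : nat) (v : 'cV[R]_3 -> 'cV[R]_3) (Q : 'M[R]_3) (c : 'cV[R]_3) : Prop :=
  forall (w : R) (x' : 'cV[R]_2), I w -> closure (Sext S) x' ->
    v (pt w x') = Q *m pt (r * w) (k%:R^-1 *: x') + c.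

Definition transition_sequences (R : realType) (S L' : set 'cV[R]_2)
    (yp ym : 'cV[R]_3) (Rp Rm : 'M[R]_3)
    (r : nat -> R) (k : nat -> nat) (v : nat -> 'cV[R]_3 -> 'cV[R]_3) : Prop :=
  [/\ forall n, [/\ 0 < r n, (0 < k n)%N & PAff S L' (r n) (k n) (v n)],
      nonincreasing_seq r /\ r n @[n \oo] --> (0 : R),
      r n * (k n)%:R @[n \oo] --> +oo
    & exists (Rpn Rmn : nat -> 'M[R]_3) (ypn ymn : nat -> 'cV[R]_3),
      [/\ forall n, SO3 (Rpn n) /\ SO3 (Rmn n),
          (Rpn n @[n \oo] --> Rp) /\ (Rmn n @[n \oo] --> Rm),
          (ypn n @[n \oo] --> yp) /\ (ymn n @[n \oo] --> ym)
        & forall n,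
          rigid_on S `[3 / 4, 1] (r n) (k n) (v n) (Rpn n) (ypn n) /\
          rigid_on S `[- 1, - (3 / 4)] (r n) (k n) (v n) (Rmn n) (ymn n)]].

Definition scaled_energy (R : realType) (L' : set 'cV[R]_2)
    (W : nat -> 'cV[R]_2 -> 'M[R]_(3, 8) -> \bar R) (r : R) (k : nat)
    (v : 'cV[R]_3 -> 'cV[R]_3) : \bar R :=
  (\sum_(x \in Lambda' L' r k) k%:R%:E * W k x.2 (cell_values r k v x))%E.

Definition limit_energies (R : realType) (S L' : set 'cV[R]_2)
    (W : nat -> 'cV[R]_2 -> 'M[R]_(3, 8) -> \bar R)
    (yp ym : 'cV[R]_3) (Rp Rm : 'M[R]_3) : set (\bar R) :=
  [set e | exists r k v, transition_sequences S L' yp ym Rp Rm r k v /\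
     e = limn_esup (fun n => scaled_energy L' W (r n) (k n) (v n))].

(* The admissible sequences depend on y+, y-, R+, R- and not only on
   u = y+ - y- and Q = (R-)^-1 R+, hence the infimum over all representations. *)
Definition phi (R : realType) (S L' : set 'cV[R]_2)
    (W : nat -> 'cV[R]_2 -> 'M[R]_(3, 8) -> \bar R)
    (u : 'cV[R]_3) (Q : 'M[R]_3) : \bar R :=
  ereal_inf [set e | exists yp ym Rp Rm,
    [/\ SO3 Rp, SO3 Rm, yp - ym = u, invmx Rm *m Rp = Q
      & limit_energies S L' W yp ym Rp Rm e]].

Definition is_minimum (R : realType) (A : set (\bar R)) (e : \bar R) : Prop :=
  A e /\ lbound A e.

Definition neighbour_pairs (R : realType) (S : set 'cV[R]_2)
    : set ('cV[R]_2 * 'cV[R]_2) :=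
  [set p | [/\ lattice S p.1, lattice S p.2 & enorm (p.1 - p.2) = 1]].

(* Main.v *)
(** The values on a lattice fibre are joined, from the left rigid part to the right
one, by about [2 r k] axial bonds, whereas the two rigid parts are a distance of
order [k |u|] apart. Hence one of these bonds has length of order at least
[|u| / r], which tends to infinity, and costs [omegaNN] in the limit. For an
ordered pair [(p, q)] of neighbouring fibres the same holds for the zigzag chain
that alternates between [p] and [q]; the chains of [(p, q)] and [(q, p)] are
disjoint and together exhaust the diagonal bonds between consecutive layers over
[p] and [q]. All these bonds are distinct, all other terms of the energy are
nonnegative, and this is the lower bound. It is attained by breaking the rod
between two consecutive layers: only the bonds across the gap have energy. *)

Require Import Defs.
From mathcomp Require Import ring lra zify.

Set Implicit Arguments.
Unset Strict Implicit.
Unset Printing Implicit Defensive.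

Local Open Scope classical_set_scope.
Local Open Scope ring_scope.

(** * The unit cell *)

(** The energy is a sum over cells, whereas the argument lives on bonds. A bond between consecutive
    layers lies in 4 cells if it is axial and in 2 if it is diagonal; over both orderings its
    weights 1/8 and 1/4 add up to 1. This holds at the lateral surface too, because [lext L']
    contains every cell with a corner at an atom. The energy of a layer is thus the full energy of
    the bonds crossing it plus a nonnegative remainder. Two obstacles shape the rest. The hypothesis
    [far_limit] concerns single sequences and must be made uniform before many bonds can be
    estimated at once. The recovery map must satisfy the conditions of [PAff] even in the broken
    layer, where it joins two different rigid motions; there an explicit formula built from
    coordinates and absolute values replaces a definition simplex by simplex. The penalty [chi] is
    harmless on broken cells, since their discrete gradients eventually leave its bounded
    neighbourhood. *)

Lemma ord2P (a : 'I_2) : a = 0 \/ a = 1.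
Proof. by case: a => [[|[|//]]] ?; [left|right]; exact: val_inj. Qed.

Lemma addmxE (V : nmodType) m n (A B : 'M[V]_(m, n)) i j :
  (A + B) i j = A i j + B i j.
Proof. by rewrite mxE. Qed.

Lemma oppmxE (V : zmodType) m n (A : 'M[V]_(m, n)) i j : (- A) i j = - A i j.
Proof. by rewrite mxE. Qed.

Lemma scalemxE (R : pzRingType) m n (c : R) (A : 'M[R]_(m, n)) i j :
  (c *: A) i j = c * A i j.
Proof. by rewrite mxE. Qed.

Lemma entry_le_norm (R : realType) m n (A : 'M[R]_(m.+1, n.+1)) i j :
  `|A i j| <= `|A|.
Proof.
rewrite [leRHS]/Num.norm/= mx_normrE.
exact: (le_bigmax _ (fun ij => `|A ij.1 ij.2|) (i, j)).
Qed.

Definition linmxE := (addmxE, oppmxE, scalemxE).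

(** The directions shifted to the vertices of the cube {0,1}^3, so that statements about the cell
    become finite boolean computations. *)
Definition cbit (a i : nat) : bool :=
  nth false (nth [::] [::
    [:: false; false; false; false; true; true; true; true];
    [:: false; false; true; true; false; false; true; true];
    [:: false; true; true; false; false; true; true; false]] a) i.

(** The squared length of a bond, since the coordinates of two corners differ by 0 or 1 in absolute
    value. *)
Definition hamming (i j : nat) : nat :=
  (cbit 0 i != cbit 0 j) + (cbit 1 i != cbit 1 j) + (cbit 2 i != cbit 2 j).

Lemma IdbarE (R : realType) (a : 'I_3) (i : 'I_8) :
  Idbar R a i = (cbit a i)%:R - 2^-1.
Proof.
rewrite /Idbar mxE /cbit.
case: a => [[|[|[|//]]] ?]; case: i => [[|[|[|[|[|[|[|[|//]]]]]]]] ?] /=; lra.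
Qed.

Lemma zE (R : realType) (i : 'I_8) (a : 'I_3) :
  z R i a 0 = (cbit a i)%:R - 2^-1.
Proof. by rewrite /z mxE IdbarE. Qed.

Lemma z1E (R : realType) (i : 'I_8) : z1 R i = (cbit 0 i)%:R - 2^-1.
Proof. exact: zE. Qed.

Lemma z'E (R : realType) (i : 'I_8) (a : 'I_2) :
  z' R i a 0 = (cbit a.+1 i)%:R - 2^-1.
Proof. by rewrite /z' mxE zE. Qed.

Lemma enorm_z (R : realType) (i j : 'I_8) :
  enorm (z R i - z R j) = Num.sqrt (hamming i j)%:R.
Proof.
rewrite /enorm; congr Num.sqrt.
have D a : (z R i - z R j) a 0 = (cbit a i)%:R - (cbit a j)%:R.
  by rewrite !linmxE !zE; ring.
rewrite !big_ord_recl !big_ord0 !D /hamming /= !natrD.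
by do 3!(case: (cbit _ i); case: (cbit _ j) => /=); ring.
Qed.

Lemma bondsE (R : realType) (A : set 'I_8) (h : nat) (p : 'I_8 * 'I_8) :
  bonds A (Num.sqrt (h%:R : R)) p
  = [&& p.1 \in A, p.2 \in A & hamming p.1 p.2 == h].
Proof.
rewrite /bonds enorm_z; congr [&& _, _ & _].
by rewrite eqr_sqrt ?ler0n// eqr_nat.
Qed.

(** Of the two orderings of a bond between the layers, the one that starts in the lower layer. *)
Definition up_bond (h : nat) (p : 'I_8 * 'I_8) : bool :=
  [&& hamming p.1 p.2 == h, ~~ cbit 0 p.1 & cbit 0 p.2].

(* Number of cells that contain a given bond of squared length [h] between two
   consecutive layers. *)
Definition bond_mult (h : nat) : nat := if h == 1%N then 4 else 2.

Lemma sum_ord_pairs (F : nat -> nat -> nat) :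
  (\sum_(p : 'I_8 * 'I_8) F p.1 p.2 =
   \sum_(0 <= i < 8) \sum_(0 <= j < 8) F i j)%N.
Proof.
rewrite -(pair_bigA _ (fun i j : 'I_8 => F i j))/= big_mkord.
by apply: eq_bigr => i _; rewrite big_mkord.
Qed.

(** The axial part of an up bond has length 1, so the squared length of its projection [(d1, d2)] is
    [h - 1]. The translates of the bond inside the cube are then counted by enumeration. *)
Lemma up_bond_count (h : nat) (d1 d2 : int) : (h == 1%N) || (h == 2%N) ->
  #|[pred p : 'I_8 * 'I_8 | [&& up_bond h p,
      (cbit 1 p.2)%:Z - (cbit 1 p.1)%:Z == d1
    & (cbit 2 p.2)%:Z - (cbit 2 p.1)%:Z == d2]]|
  = (if d1 ^+ 2 + d2 ^+ 2 == h.-1%:Z then bond_mult h else 0%N).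
Proof.
move=> h12; rewrite -sum1_card big_mkcond/=.
pose F := fun i j : nat => (if [&& (hamming i j == h), ~~ cbit 0 i & cbit 0 j] &&
      (((cbit 1 j)%:Z - (cbit 1 i)%:Z == d1)
    && ((cbit 2 j)%:Z - (cbit 2 i)%:Z == d2)) then 1%N else 0%N).
rewrite (eq_bigr (fun p : 'I_8 * 'I_8 => F p.1 p.2)); last first.
  by move=> p _; rewrite inE.
rewrite sum_ord_pairs {}/F.
(* Nine of the sixteen cases are decided by evaluating the double sum. In the other seven, [d1] or
   [d2] is not a difference of two bits and both sides vanish. *)
have [->|d10] := eqVneq d1 0; [|have [->|d11] := eqVneq d1 1;
  [|have [->|d1N] := eqVneq d1 (-1)]];
(have [->|d20] := eqVneq d2 0; [|have [->|d21] := eqVneq d2 1;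
  [|have [->|d2N] := eqVneq d2 (-1)]]).
all: try by case/orP: h12 => /eqP ->; rewrite unlock.
all: rewrite [RHS]ifF; first last.
all: try by case/orP: h12 => /eqP ->; apply/negbTE/eqP; nia.
all: apply: big1_seq => i _; apply: big1_seq => j _; case: ifP => //.
all: move=> /andP[_ /andP[/eqP e1 /eqP e2]]; exfalso.
all: by move: e1 e2; case: (cbit 1 i); case: (cbit 1 j); case: (cbit 2 i); case: (cbit 2 j); lia.
Qed.

(** * The cross-section *)

Lemma finite_bounded_int (N : nat) : finite_set [set m : int | (`|m| <= N)%N].
Proof.
apply: (@sub_finite_set _ _
  ([set m%:Z | m in `I_N.+1] `|` [set - m%:Z | m in `I_N.+1])); last first.
  by rewrite finite_setU; split; apply: finite_image; apply: finite_II.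
move=> m /= mN; have [m0|m0] := leP 0 m; [left|right]; exists `|m|%N => //; lia.
Qed.

Lemma absz_le_truncn (R : realType) (M : R) (m : int) :
  `|m%:~R| <= M -> (`|m| <= Num.truncn M)%N.
Proof.
rewrite -intr_norm => mM; have M0 : 0 <= M by exact: le_trans mM.
by rewrite truncn_ge_nat// natr_absz.
Qed.

Lemma finite_bounded_integer_points (R : realType) (M : R) :
  finite_set [set p : 'cV[R]_2 | integer_points p /\ forall a, `|p a 0| <= M].
Proof.
have finI := finite_bounded_int (Num.truncn M); set I := [set m | _] in finI.
apply: (@sub_finite_set _ _ [set (\col_a (if a == 0 then m else n)%:~R : 'cV[R]_2)
    | m in I & n in I]); last exact: finite_image2.
move=> p [pint pM].
have /intrP[m em] := pint 0; have /intrP[n en] := pint 1.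
exists m; first by apply: (@absz_le_truncn R); rewrite -em.
exists n; first by apply: (@absz_le_truncn R); rewrite -en.
apply/matrixP => a b; rewrite (ord1 b) mxE.
by case: (ord2P a) => ->; rewrite ?em ?en.
Qed.

Section CrossSection.
Variables (R : realType) (S L' : set 'cV[R]_2).
Hypothesis hS : cross_section S L'.

Lemma centre_half_integer x' a : L' x' -> exists m : int, x' a 0 = m%:~R + 2^-1.
Proof.
move=> /(cs_centres hS)/(_ a)/intrP[m e]; exists m; rewrite -e; ring.
Qed.

Lemma z'_bound (i : 'I_8) a : `|z' R i a 0| = 2^-1.
Proof.
rewrite z'E; case: cbit => /=; last by rewrite sub0r normrN ger0_norm// invr_ge0.
by rewrite ger0_norm; lra.
Qed.

(** The corner need not lie in the open set [S], but the points [x' + (1 - t) z'] do: the sup-norm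
    ball of radius [t / 2] around them stays in the unit square, and they tend to the corner as [t]
    tends to 0. *)
Lemma lattice_corner x' i : L' x' -> lattice S (x' + z' R i).
Proof.
move=> Lx; split; last first.
  move=> a; rewrite linmxE z'E; have [m ->] := centre_half_integer a Lx.
  by rewrite addrACA subrr addr0 rpredD// ?intr_int// natr_int.
move=> B /nbhs_ballP[e /= e0 eB].
pose t := Num.min (e / 2) 2^-1.
have t0 : 0 < t by rewrite lt_min divr_gt0//= invr_gt0.
have te : t <= e / 2 by rewrite ge_min lexx.
have t1 : t <= 2^-1 by rewrite ge_min lexx orbT.
exists (x' + (1 - t) *: z' R i); split; last first.
  apply: eB; split=> // a b; rewrite (ord1 b) /ball/= !linmxE.
  have := z'_bound i a; set s := (z' R i a 0) => sz.
  have -> : x' a 0 + s - (x' a 0 + (1 - t) * s) = t * s by ring.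
  rewrite normrM sz gtr0_norm//; lra.
rewrite (cs_cells hS); apply/nbhs_ballP; exists (t / 2); first by rewrite /= divr_gt0.
move=> y yB; exists x' => // a.
have := yB.2 a 0; rewrite /ball/= !linmxE.
have := z'_bound i a; set s := z' R i a 0 => sz.
move=> yb.
have -> : y a 0 - x' a 0 = (1 - t) * s - (x' a 0 + (1 - t) * s - y a 0) by ring.
rewrite (le_trans (ler_normB _ _))// normrM sz ger0_norm; lra.
Qed.

Lemma lattice_near_centre p : lattice S p ->
  exists2 x', L' x' & forall a, exists b : bool, p a 0 - x' a 0 = b%:R - 2^-1.
Proof.
move=> [pS pint].
(* With radius 1/4 each coordinate of [p - x'] is below 1/2 + 1/4 in absolute value, and the only
   such half-integers are -1/2 and 1/2. *)
have [|y [yS yp]] := pS (ball p 4^-1); first exact: nbhsx_ballx.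
move: yS; rewrite (cs_cells hS) => /interior_subset[x' Lx yx].
exists x' => // a.
have [m em] := centre_half_integer a Lx.
have /intrP[n en] := pint a.
have := yp.2 a 0; rewrite /ball/= => h1; have h2 := yx a.
have : `|(n - m)%:~R - 2^-1| < (3 / 4 : R).
  have -> : (n - m)%:~R - 2^-1 = (p a 0 - y a 0) + (y a 0 - x' a 0).
    by rewrite em en intrB; ring.
  rewrite (le_lt_trans (ler_normD _ _))//; lra.
rewrite ltr_norml => /andP[g1 g2].
have nm : (n - m == 0) || (n - m == 1).
  have : ((-1)%:~R < (n - m)%:~R :> R) && ((n - m)%:~R < 2%:~R :> R).
    by apply/andP; split; lra.
  rewrite !ltr_int; lia.
rewrite en em; case/orP: nm => /eqP nm.
  by exists false; rewrite /= (_ : n = m); [ring|lia].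
by exists true; rewrite /= (_ : n = m + 1); [rewrite intrD; ring|lia].
Qed.

(** All four cells around an atom of the cross-section are available: the atom is a corner of some
    cell in [L'], and cells with a common corner have centres that differ by -1, 0 or 1 in each
    coordinate. Hence no bond at the surface loses a share of its weight. *)
Lemma lext_of_lattice p i : lattice S p -> lext L' (p - z' R i).
Proof.
move=> /lattice_near_centre[x' Lx px]; exists x' => //.
exists (p - z' R i - x'); last by rewrite addrC subrK.
move=> a; have [b pb] := px a.
have -> : (p - z' R i - x') a 0 = b%:R - (cbit a.+1 i)%:R.
  have -> : (p - z' R i - x') a 0 = (p a 0 - x' a 0) - z' R i a 0 by rewrite !linmxE; ring.
  by rewrite pb z'E; ring.
rewrite !inE; case: b {pb}; case: cbit => /=;
  by rewrite ?subrr ?subr0 ?sub0r ?eqxx ?orbT.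
Qed.

Lemma finite_lattice : finite_set (lattice S).
Proof.
have [M [_ MS]] := cs_bounded hS.
apply: sub_finite_set (@finite_bounded_integer_points R (M + 2)) => p [pS pint].
split=> // a.
have [|y [yS yp]] := pS (ball p 4^-1); first exact: nbhsx_ballx.
have yM : `|y| <= M + 1 by apply: MS => //; rewrite ltrDl.
have ya : `|y a 0| <= M + 1.
  exact: le_trans (entry_le_norm _ _ _) yM.
have := yp.2 a 0; rewrite /ball/= => h1.
have -> : p a 0 = (p a 0 - y a 0) + y a 0 by rewrite subrK.
rewrite (le_trans (ler_normD _ _))//; lra.
Qed.

Lemma finite_lext : finite_set (lext L').
Proof.
apply: (@finite_image2 _ _ _ _ _ +%R).
  apply: (@sub_finite_set _ _ [set p - z' R ord0 | p in lattice S]).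
    by move=> x' Lx; exists (x' + z' R ord0); [exact: lattice_corner|rewrite addrK].
  exact/finite_image/finite_lattice.
apply: sub_finite_set (@finite_bounded_integer_points R 1) => d ds.
split=> a; have := ds a; rewrite !inE => /or3P[] /eqP ->.
- by rewrite rpredN rpred1.
- by rewrite rpred0.
- by rewrite rpred1.
- by rewrite normrN normr1.
- by rewrite normr0.
- by rewrite normr1.
Qed.

Lemma lattice_closure_Sext p : lattice S p -> closure (Sext S) p.
Proof.
move=> [pS _]; apply: (closure_subset _ pS) => y Sy.
exists y => //; exists 0; last by rewrite addr0.
by move=> a; rewrite mxE normr0.
Qed.

End CrossSection.

(** * From cells to bonds *)

Lemma enorm_ge0 (R : realType) m n (A : 'M[R]_(m, n)) : 0 <= enorm A.
Proof. exact: sqrtr_ge0. Qed.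

Lemma enorm_cV2 (R : realType) (A : 'cV[R]_2) :
  enorm A = Num.sqrt (A 0 0 ^+ 2 + A 1 0 ^+ 2).
Proof.
rewrite /enorm !big_ord_recl !big_ord0 !addr0.
by congr (Num.sqrt (_ + A _ _ ^+ 2)); apply: val_inj.
Qed.

Lemma enormN (R : realType) m n (A : 'M[R]_(m, n)) : enorm (- A) = enorm A.
Proof.
rewrite /enorm; congr Num.sqrt; apply: eq_bigr => i _; apply: eq_bigr => j _.
by rewrite linmxE sqrrN.
Qed.

(* Projections to the cross-section of the bonds of squared length [h] between
   consecutive layers. *)
Definition bond_pairs (R : realType) (S : set 'cV[R]_2) (h : nat)
    : set ('cV[R]_2 * 'cV[R]_2) :=
  [set p | [/\ lattice S p.1, lattice S p.2
             & enorm (p.1 - p.2) = Num.sqrt h.-1%:R]].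

Lemma bond_pairs1 (R : realType) (S : set 'cV[R]_2) :
  bond_pairs S 1 = [set (p, p) | p in lattice S].
Proof.
apply/seteqP; split => [[p q] [/= Lp Lq]|_ [p Lp <-]]; last first.
  by split=> //=; rewrite subrr enorm_cV2 !mxE expr0n/= addr0.
rewrite enorm_cV2 sqrtr0 => /eqP; rewrite sqrtr_eq0 => le0.
have /andP[/eqP e0 /eqP e1] : ((p - q) 0 0 == 0) && ((p - q) 1 0 == 0).
  rewrite -(sqrf_eq0 ((p - q) 0 0)) -(sqrf_eq0 ((p - q) 1 0)); apply/andP.
  have := sqr_ge0 ((p - q) 0 0); have := sqr_ge0 ((p - q) 1 0).
  by move=> h1 h0; split; rewrite eq_le; apply/andP; split; lra.
exists p => //; congr (_, _); apply/matrixP => a b; rewrite (ord1 b).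
apply/eqP; rewrite -subr_eq0 -oppmxE -addmxE.
by case: (ord2P a) => ->; rewrite ?e0 ?e1.
Qed.

Lemma bond_pairs2 (R : realType) (S : set 'cV[R]_2) :
  bond_pairs S 2 = neighbour_pairs S.
Proof. by rewrite /bond_pairs/= sqrtr1. Qed.

Lemma bond_pairs_swap (R : realType) (S : set 'cV[R]_2) h p q :
  bond_pairs S h (p, q) -> bond_pairs S h (q, p).
Proof. by move=> [/= Lp Lq e]; split => //=; rewrite -enormN opprB. Qed.

(** A bond [e] of the cell with the projection [q - p] determines the one cell in which it joins [p]
    to [q], so this is the number of cells sharing the bond. *)
Lemma up_bond_pair_count (R : realType) (h : nat) (p q : 'cV[R]_2) :
  (h == 1%N) || (h == 2%N) -> integer_points p -> integer_points q ->
  #|[pred e : 'I_8 * 'I_8 | up_bond h e && (q - p == z' R e.2 - z' R e.1)]|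
  = (if enorm (p - q) == Num.sqrt h.-1%:R then bond_mult h else 0%N).
Proof.
move=> h12 pint qint.
have intd a : exists n : int, (q - p) a 0 = n%:~R.
  have /intrP[m em] := pint a; have /intrP[n en] := qint a.
  by exists (n - m); rewrite !linmxE em en intrB.
have [[d1 e1] [d2 e2]] := (intd 0, intd 1).
rewrite -enormN opprB enorm_cV2 e1 e2 -!rmorphXn -rmorphD/= eqr_sqrt ?ler0n//; last first.
  by rewrite ler0z addr_ge0// sqr_ge0.
rewrite -[h.-1%:R]/(h.-1%:Z%:~R) eqr_int -(up_bond_count _ _ h12).
apply: eq_card => e; rewrite !inE; congr (_ && _).
have bitE (i j : 'I_8) (a : 'I_2) (d : int) :
    ((z' R j - z' R i) a 0 == d%:~R) = ((cbit a.+1 j)%:Z - (cbit a.+1 i)%:Z == d).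
  rewrite !linmxE !z'E opprB addrA subrK -(eqr_int R) intrB.
  by [].
rewrite -[in RHS](bitE _ _ 0) -[in RHS](bitE _ _ 1) -e1 -e2.
apply/idP/andP => [/eqP ->//|[/eqP f1 /eqP f2]].
apply/eqP/matrixP => a b; rewrite (ord1 b).
by case: (ord2P a) => ->.
Qed.

Lemma fsume_split (R : realType) (I : choiceType) (P : set I) (f g : I -> \bar R) :
  finite_set P ->
  (\sum_(x \in P) (f x + g x) = \sum_(x \in P) f x + \sum_(x \in P) g x)%E.
Proof. exact: fsbig_split. Qed.

Section CellSums.
Variables (R : realType) (S L' : set 'cV[R]_2).
Hypothesis hS : cross_section S L'.

Lemma finite_bond_pairs h : finite_set (bond_pairs S h).
Proof.
apply: (@sub_finite_set _ _ (lattice S `*` lattice S)).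
  by move=> [p q] [].
exact/finite_setX/(finite_lattice hS)/(finite_lattice hS).
Qed.

(** Double counting. For a fixed [e], the cells in which both ends of [e] are atoms correspond
    bijectively to the pairs of lattice points with difference [z' e.2 - z' e.1]; [lext_of_lattice]
    gives surjectivity. After the sums are exchanged, each pair is counted as often as
    [up_bond_pair_count] says. *)
Lemma up_bond_sum (h : nat) (G : 'cV[R]_2 -> 'cV[R]_2 -> \bar R) :
  (h == 1%N) || (h == 2%N) ->
  \sum_(x' \in lext L') \sum_(e | up_bond h e &&
      ((e.1 \in surf_sites S x') && (e.2 \in surf_sites S x')))
    G (x' + z' R e.1) (x' + z' R e.2)
  = \sum_(p \in bond_pairs S h) (G p.1 p.2 *+ bond_mult h).
Proof.
move=> h12.
have finL := finite_lattice hS; have finE := finite_lext hS.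
have finLL : finite_set (lattice S `*` lattice S) by exact: finite_setX.
pose C (e : 'I_8 * 'I_8) : set 'cV[R]_2 :=
  [set x' | lattice S (x' + z' R e.1) /\ lattice S (x' + z' R e.2)].
pose D (e : 'I_8 * 'I_8) : set ('cV[R]_2 * 'cV[R]_2) :=
  [set p | p.2 - p.1 = z' R e.2 - z' R e.1].
have reindex e : \sum_(x' \in lext L' `&` C e) G (x' + z' R e.1) (x' + z' R e.2)
    = \sum_(p \in (lattice S `*` lattice S) `&` D e) G p.1 p.2.
  rewrite (reindex_fsbig (fun x' => (x' + z' R e.1, x' + z' R e.2))
    (lext L' `&` C e))//; split.
  - by move=> x' [_ [c1 c2]]; split => //=; rewrite /D/= opprD addrACA subrr add0r.
  - by move=> x y _ _ [/addIr].
  - move=> [p q] [[/= Lp Lq]]; rewrite /D/= => pq.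
    exists (p - z' R e.1); last first.
      by rewrite subrK -addrA [- _ + _]addrC -pq addrC subrK.
    split; first exact: (lext_of_lattice hS).
    rewrite /C/= subrK; split => //.
    by rewrite -addrA [- _ + _]addrC -pq addrC subrK.
transitivity (\sum_(e | up_bond h e) \sum_(p \in lattice S `*` lattice S)
    if p \in D e then G p.1 p.2 else 0%E).
  rewrite fsbig_finite//.
  under eq_bigr do rewrite big_mkcondr/=.
  rewrite exchange_big/=; apply: eq_bigr => e _.
  rewrite -fsbig_mkcondr -reindex fsbig_mkcondr fsbig_finite//.
  apply: eq_bigr => x' _; congr (if _ then _ else _).
  by apply/andP/idP => [[/set_mem ? /set_mem ?]|/set_mem[? ?]];
    [exact/mem_set|split; exact/mem_set].
under eq_bigr do rewrite fsbig_finite//.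
rewrite exchange_big/= -fsbig_finite//.
have -> : bond_pairs S h = (lattice S `*` lattice S) `&`
    [set p | enorm (p.1 - p.2) = Num.sqrt h.-1%:R].
  by apply/seteqP; split => [p []|p [[]]].
rewrite [RHS]fsbig_mkcondr; apply: eq_fsbigr => -[p q] /set_mem[/= Lp Lq].
rewrite -big_mkcondr/= (eq_bigl (mem [pred e : 'I_8 * 'I_8 | up_bond h e &&
    (q - p == z' R e.2 - z' R e.1)])); last first.
  by move=> e; rewrite !inE; congr (_ && _); apply/idP/eqP => [/set_mem//|?]; exact/mem_set.
rewrite sumr_const up_bond_pair_count//; [|exact: Lp.2|exact: Lq.2].
have -> : ((p, q) \in [set p : 'cV[R]_2 * 'cV[R]_2 | enorm (p.1 - p.2) = Num.sqrt h.-1%:R])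
    = (enorm (p - q) == Num.sqrt h.-1%:R) by apply/idP/eqP => [/set_mem//|?]; exact/mem_set.
by case: ifP; rewrite ?mulr0n.
Qed.

Definition horizontal (e : 'I_8 * 'I_8) : bool := cbit 0 e.1 == cbit 0 e.2.

(** The condition on [c] says that the share [c], collected over the cells containing a bond and
    over its two orderings, is 1. It holds for [c = 1/8], [h = 1] and for [c = 1/4], [h = 2]. *)
Lemma bond_sum (h : nat) (c : R) (F : 'cV[R]_2 -> 'I_8 * 'I_8 -> \bar R)
    (G : 'cV[R]_2 -> 'cV[R]_2 -> \bar R) :
  (h == 1%N) || (h == 2%N) -> 0 <= c -> c *+ bond_mult h + c *+ bond_mult h = 1 ->
  (forall x' e, (0 <= F x' e)%E) -> (forall p q, (0 <= G p q)%E) ->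
  (forall x' i j, F x' (i, j) = F x' (j, i)) ->
  (forall x' e, up_bond h e -> F x' e = G (x' + z' R e.1) (x' + z' R e.2)) ->
  (\sum_(x' \in lext L')
     c%:E * \sum_(e | bonds (surf_sites S x') (Num.sqrt (h%:R : R)) e) F x' e)%E
  = (\sum_(p \in bond_pairs S h) G p.1 p.2
    + \sum_(x' \in lext L') c%:E *
        \sum_(e | bonds (surf_sites S x') (Num.sqrt (h%:R : R)) e && horizontal e)
          F x' e)%E.
Proof.
move=> h12 c0 c1 F0 G0 Fsym FG.
have finE := finite_lext hS.
pose U x' := (\sum_(e | up_bond h e &&
      ((e.1 \in surf_sites S x') && (e.2 \in surf_sites S x'))) F x' e)%E.
pose H x' := (\sum_(e | bonds (surf_sites S x') (Num.sqrt (h%:R : R)) e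
  && horizontal e) F x' e)%E.
have U0 x' : (0 <= U x')%E by exact: sume_ge0.
have H0 x' : (0 <= H x')%E by exact: sume_ge0.
have split3 x' : (\sum_(e | bonds (surf_sites S x') (Num.sqrt (h%:R : R)) e) F x' e
    = (U x' + U x') + H x')%E.
  rewrite (bigID horizontal)/= addeC; congr (_ + _)%E.
  rewrite (bigID (fun e : 'I_8 * 'I_8 => cbit 0 e.2))/=; congr (_ + _)%E.
    apply: eq_bigl => e; rewrite bondsE /horizontal /up_bond.
    by case: (_ \in _); case: (_ \in _); case: (cbit 0 _); case: (cbit 0 _);
      case: (_ == _).
  (* The downward bonds become upward ones when their ends are exchanged. *)
  rewrite (reindex_inj (h := fun e : 'I_8 * 'I_8 => (e.2, e.1)))/=; last by move=> [? ?] [? ?] [-> ->].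
  rewrite /U; apply: eq_big => [e|[i j] _]; last exact: Fsym.
  rewrite bondsE /horizontal /up_bond/=.
  have -> : hamming e.2 e.1 = hamming e.1 e.2.
    by rewrite /hamming; congr (_ + _ + _)%N; rewrite eq_sym.
  by case: (_ \in _); case: (_ \in _); case: (cbit 0 _); case: (cbit 0 _);
      case: (_ == _).
have sumU : (\sum_(x' \in lext L') U x' =
    (bond_mult h)%:R%:E * \sum_(p \in bond_pairs S h) G p.1 p.2)%E.
  have finP := finite_bond_pairs h.
  transitivity ((\sum_(p \in bond_pairs S h) G p.1 p.2) *+ bond_mult h)%R; last first.
    by rewrite mule_natl /bond_mult; case: ifP.
  rewrite [in RHS]fsbig_finite// -sumrMnl -fsbig_finite//.
  rewrite -up_bond_sum//; apply: eq_fsbigr => x' _.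
  by apply: eq_bigr => e /andP[/FG].
under eq_fsbigr => x' _.
  rewrite split3 ge0_muleDr ?adde_ge0// ge0_muleDr//.
  over.
rewrite !fsume_split//; congr (_ + _)%E.
rewrite -ge0_mule_fsumr// sumU muleA -EFinM -ge0_muleDl ?lee_fin ?mulr_ge0//.
by rewrite -EFinD !mulr_natr c1 mul1e.
Qed.

End CellSums.

(** * Energy of the layers *)

Section Layers.
Variables (R : realType) (S L' : set 'cV[R]_2) (cf : nat -> R).
Variables (WNN WNNN WbarNN WbarNNN : nat -> R -> \bar R) (W0NN W0NNN : R -> R).
Variable chi : nat -> 'M[R]_(3, 8) -> R.
Hypothesis hS : cross_section S L'.
Hypothesis hNN : pair_potential cf WNN WbarNN W0NN.
Hypothesis hNNN : pair_potential cf WNNN WbarNNN W0NNN.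
Hypothesis hchi : orientation_penalty chi.

Local Notation W := (Wtot L' (Wcell WNN WNNN chi) (Wsurf S WNN WNNN)).

(** The remainder of a cell energy once the bonds between its two layers are removed. The lower
    bound drops it, as it is nonnegative; on the broken layer of the recovery sequence it
    vanishes. *)
Definition horizontal_energy k (x' : 'cV[R]_2) (y : 'M[R]_(3, 8)) : \bar R :=
  ((8^-1)%:E * \sum_(e | bonds (surf_sites S x') (Num.sqrt (1%:R : R)) e
      && horizontal e) WNN k (bond_length y e)
  + (4^-1)%:E * \sum_(e | bonds (surf_sites S x') (Num.sqrt (2%:R : R)) e
      && horizontal e) WNNN k (bond_length y e / Num.sqrt 2)%R
  + (if x' \in L' then chi k y else 0%R)%:E)%E.

Lemma chi_ge0 k y : (0 < k)%N -> 0 <= chi k y.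
Proof. by move=> k0; have [C /(_ k y k0)/andP[]] := op_bounds hchi. Qed.

Lemma WNN_ge0 k r : (0 < k)%N -> 0 <= r -> (0 <= WNN k r)%E.
Proof. exact: (pp_ge0 hNN). Qed.

Lemma WNNN_ge0 k r : (0 < k)%N -> 0 <= r -> (0 <= WNNN k (r / Num.sqrt 2)%R)%E.
Proof. by move=> k0 r0; apply: (pp_ge0 hNNN) => //; rewrite divr_ge0. Qed.

Lemma horizontal_energy_ge0 k x' y : (0 < k)%N -> (0 <= horizontal_energy k x' y)%E.
Proof.
move=> k0; rewrite /horizontal_energy !adde_ge0//.
- rewrite mule_ge0 ?lee_fin ?invr_ge0//; apply: sume_ge0 => e _.
  by apply: WNN_ge0 => //; exact: enorm_ge0.
- rewrite mule_ge0 ?lee_fin ?invr_ge0//; apply: sume_ge0 => e _.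
  by apply: WNNN_ge0 => //; exact: enorm_ge0.
- by rewrite lee_fin; case: ifP => // _; exact: chi_ge0.
Qed.

(** Over [L'] all eight corners are atoms, so bulk and surface cells have the same bond part. *)
Lemma Wtot_bonds k x' y : W k x' y =
  (bond_energy WNN WNNN k (surf_sites S x') y
   + (if x' \in L' then chi k y else 0%R)%:E)%E.
Proof.
rewrite /Wtot; case: ifPn => [/set_mem Lx|_]; last by rewrite adde0.
rewrite /Wcell; congr (bond_energy _ _ _ _ _ + _)%E.
by apply/seteqP; split => // i _; exact: (lattice_corner hS).
Qed.

Lemma bond_lengthC (y : 'M[R]_(3, 8)) i j : bond_length y (i, j) = bond_length y (j, i).
Proof. by rewrite /bond_length/= -enormN opprB. Qed.

(** [U false] and [U true] are the atomic positions in the lower and the upper layer; the hypothesis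
    on [U] expresses that neighbouring cells share their corners. *)
Lemma layer_energy k (y : 'cV[R]_2 -> 'M[R]_(3, 8)) (U : bool -> 'cV[R]_2 -> 'cV[R]_3) :
  (0 < k)%N ->
  (forall x' i, col i (y x') = U (cbit 0 i) (x' + z' R i)) ->
  (\sum_(x' \in lext L') W k x' (y x') =
   \sum_(p \in bond_pairs S 1) WNN k (enorm (U false p.1 - U true p.2))
   + \sum_(p \in bond_pairs S 2)
       WNNN k (enorm (U false p.1 - U true p.2) / Num.sqrt 2)%R
   + \sum_(x' \in lext L') horizontal_energy k x' (y x'))%E.
Proof.
move=> k0 yU; have finE := finite_lext hS.
have lenU x' h e : up_bond h e ->
    bond_length (y x') e = enorm (U false (x' + z' R e.1) - U true (x' + z' R e.2)).
  by move=> /and3P[_ /negbTE e1 e2]; rewrite /bond_length !yU e1 e2.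
have bE A x : bond_energy WNN WNNN k A x =
    ((8^-1)%:E * \sum_(e | bonds A (Num.sqrt (1%:R : R)) e) WNN k (bond_length x e)
    + (4^-1)%:E * \sum_(e | bonds A (Num.sqrt (2%:R : R)) e)
        WNNN k (bond_length x e / Num.sqrt 2)%R)%E.
  by rewrite /bond_energy sqrtr1.
pose X x' : \bar R := (if x' \in L' then chi k (y x') else 0%R)%:E.
pose B1 x' := ((8^-1)%:E * \sum_(e | bonds (surf_sites S x') (Num.sqrt (1%:R : R)) e)
  WNN k (bond_length (y x') e))%E.
pose B2 x' := ((4^-1)%:E * \sum_(e | bonds (surf_sites S x') (Num.sqrt (2%:R : R)) e)
  WNNN k (bond_length (y x') e / Num.sqrt 2)%R)%E.
pose H1 x' := ((8^-1)%:E * \sum_(e | bonds (surf_sites S x') (Num.sqrt (1%:R : R)) e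
  && horizontal e) WNN k (bond_length (y x') e))%E.
pose H2 x' := ((4^-1)%:E * \sum_(e | bonds (surf_sites S x') (Num.sqrt (2%:R : R)) e
  && horizontal e) WNNN k (bond_length (y x') e / Num.sqrt 2)%R)%E.
have sum3 (f g h : 'cV[R]_2 -> \bar R) : (\sum_(x' \in lext L') (f x' + g x' + h x') =
    \sum_(x' \in lext L') f x' + \sum_(x' \in lext L') g x'
    + \sum_(x' \in lext L') h x')%E.
  by rewrite (@fsume_split _ _ _ (fun x' => f x' + g x')%E h)// (@fsume_split _ _ _ f g).
have -> : (\sum_(x' \in lext L') W k x' (y x') =
    \sum_(x' \in lext L') (B1 x' + B2 x' + X x'))%E.
  by apply: eq_fsbigr => x' _; rewrite Wtot_bonds bE.
have -> : (\sum_(x' \in lext L') horizontal_energy k x' (y x') =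
    \sum_(x' \in lext L') (H1 x' + H2 x' + X x'))%E by [].
have -> : (\sum_(x' \in lext L') (B1 x' + B2 x' + X x') = \sum_(x' \in lext L') B1 x'
    + \sum_(x' \in lext L') B2 x' + \sum_(x' \in lext L') X x')%E by exact: sum3.
have -> : (\sum_(x' \in lext L') B1 x' =
    \sum_(p \in bond_pairs S 1) WNN k (enorm (U false p.1 - U true p.2))
    + \sum_(x' \in lext L') H1 x')%E.
  apply: (@bond_sum _ _ _ hS 1 8^-1 (fun x' e => WNN k (bond_length (y x') e))
    (fun p q => WNN k (enorm (U false p - U true q)))) => //.
  - by rewrite /bond_mult/=; lra.
  - by move=> x' e; apply: WNN_ge0 => //; exact: enorm_ge0.
  - by move=> p q; apply: WNN_ge0 => //; exact: enorm_ge0.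
  - by move=> x' i j; rewrite bond_lengthC.
  - by move=> x' e /lenU ->.
have -> : (\sum_(x' \in lext L') B2 x' =
    \sum_(p \in bond_pairs S 2)
      WNNN k (enorm (U false p.1 - U true p.2) / Num.sqrt 2)%R
    + \sum_(x' \in lext L') H2 x')%E.
  apply: (@bond_sum _ _ _ hS 2 4^-1
    (fun x' e => WNNN k (bond_length (y x') e / Num.sqrt 2)%R)
    (fun p q => WNNN k (enorm (U false p - U true q) / Num.sqrt 2)%R)) => //.
  - by rewrite /bond_mult/=; lra.
  - by move=> x' e; apply: WNNN_ge0 => //; exact: enorm_ge0.
  - by move=> p q; apply: WNNN_ge0 => //; exact: enorm_ge0.
  - by move=> x' i j; rewrite bond_lengthC.
  - by move=> x' e /lenU ->.
rewrite [in RHS]sum3 -!addeA; congr (_ + _)%E; exact: addeCA.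
Qed.

(** Cells are indexed by the atomic layer below them: index [m] stands for the cells centred at
    [h / 2 + m h], between the atoms at [m h] and [(m + 1) h]. *)
Definition layers (h : R) : set int :=
  [set m | - 1 - h / 2 < h / 2 + m%:~R * h < 1 + h / 2].

Lemma finite_layers h : 0 < h -> finite_set (layers h).
Proof.
move=> h0; apply: sub_finite_set (finite_bounded_int (Num.truncn (h^-1 + 1))) => m.
move=> /andP[m1 m2]; apply: (@absz_le_truncn R); rewrite ler_norml.
have hh : h^-1 * h = 1 by rewrite mulVf// gt_eqF.
by apply/andP; split; rewrite -(ler_pM2r h0); lra.
Qed.

Definition atom (r : R) k (v : 'cV[R]_3 -> 'cV[R]_3) (m : int) (p : 'cV[R]_2) : 'cV[R]_3 :=
  k%:R *: v (pt (m%:~R * mesh r k) p).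

Definition cell_at (r : R) k v (m : int) (x' : 'cV[R]_2) : 'M[R]_(3, 8) :=
  cell_values r k v (mesh r k / 2 + m%:~R * mesh r k, x').

Lemma col_cell_at r k v m x' i :
  col i (cell_at r k v m x') = atom r k v (if cbit 0 i then m + 1 else m) (x' + z' R i).
Proof.
apply/matrixP => a b; rewrite (ord1 b) /atom !mxE /corner/= z1E.
by congr (_ * v (pt _ _) _ _); case: cbit => /=; rewrite ?intrD; ring.
Qed.

Lemma W_ge0 k x' y : (0 < k)%N -> (0 <= W k x' y)%E.
Proof.
move=> k0; rewrite Wtot_bonds adde_ge0//; last first.
  by rewrite lee_fin; case: ifP => // _; exact: chi_ge0.
rewrite /bond_energy adde_ge0// mule_ge0 ?lee_fin ?invr_ge0//; apply: sume_ge0 => e _.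
  by apply: WNN_ge0 => //; exact: enorm_ge0.
by apply: WNNN_ge0 => //; exact: enorm_ge0.
Qed.

Definition bond (r : R) k v (m : int) (p : 'cV[R]_2 * 'cV[R]_2) : R :=
  enorm (atom r k v m p.1 - atom r k v (m + 1) p.2).

Lemma scaled_energy_layers r k v : 0 < r -> (0 < k)%N ->
  (scaled_energy L' W r k v = \sum_(m \in layers (mesh r k)) (k%:R%:E *
     \sum_(x' \in lext L') W k x' (cell_at r k v m x')))%E.
Proof.
move=> r0 k0; rewrite /scaled_energy.
have h0 : 0 < mesh r k by rewrite invr_gt0 mulr_gt0 ?ltr0n.
have finM := finite_layers h0; have finE := finite_lext hS.
under [in RHS]eq_fsbigr do rewrite (ge0_mule_fsumr _ _ (fun x' => W_ge0 _ _ k0)).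
rewrite pair_fsbig//.
rewrite (reindex_fsbig (fun mx : int * 'cV[R]_2 =>
  (mesh r k / 2 + mx.1%:~R * mesh r k, mx.2)) (layers (mesh r k) `*` lext L'))//.
split.
- by move=> [m x'] [/= mM Lx]; split => //=; exists m.
- move=> [m x] [n y] _ _ [/addrI/(mulIf (lt0r_neq0 h0))/eqP].
  by rewrite eqr_int => /eqP -> ->.
- by move=> [w x'] [/= [m ->] wb Lx]; exists (m, x').
Qed.

Lemma scaled_energy_bonds r k v : 0 < r -> (0 < k)%N ->
  (scaled_energy L' W r k v = \sum_(m \in layers (mesh r k)) (k%:R%:E *
   (\sum_(p \in bond_pairs S 1) WNN k (bond r k v m p)
   + \sum_(p \in bond_pairs S 2) WNNN k (bond r k v m p / Num.sqrt 2)%R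
   + \sum_(x' \in lext L') horizontal_energy k x' (cell_at r k v m x'))))%E.
Proof.
move=> r0 k0; rewrite scaled_energy_layers//; apply: eq_fsbigr => m _.
congr (_ * _)%E.
by apply: (layer_energy k0 (U := fun b => atom r k v (if b then m + 1 else m)))
  => x' i; exact: col_cell_at.
Qed.

End Layers.

(** * Broken bonds *)

(** Were uniformity to fail, there would be counterexamples with index and length at least [N] for
    every [N]. They are assembled into one sequence of lengths tending to infinity, which
    contradicts [far_limit]. *)
Lemma far_limit_uniform (R : realType) (Wbar : nat -> R -> \bar R) (omega : R) :
  far_limit Wbar omega -> forall e : R, 0 < e -> exists N : nat,
    forall k r, (N <= k)%N -> N%:R <= r ->
      ((omega - e)%:E <= k%:R%:E * Wbar k r <= (omega + e)%:E)%E.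
Proof.
move=> far e e0; apply: contrapT => noN.
have bad (N : nat) : exists kr : nat * R, [/\ (N <= kr.1)%N, N%:R <= kr.2 &
    ~ ((omega - e)%:E <= kr.1%:R%:E * Wbar kr.1 kr.2 <= (omega + e)%:E)%E].
  apply: contrapT => nobad; apply: noN; exists N => k r Nk Nr.
  by apply: contrapT => b; apply: nobad; exists (k, r).
have [f fP] := choice bad.
(* If several counterexamples have the index [k], any one of them will do; at indices without
   counterexample the default [k] keeps the sequence divergent. *)
pose r k : R := if pselect (exists N, (f N).1 = k) is left ex
  then (f (projT1 (cid ex))).2 else k%:R.
have roo : r k @[k \oo] --> +oo.
  apply/cvgryPge => A.
  have [M AM] : exists M : nat, A <= M%:R.
    by exists (Num.truncn A).+1; rewrite ltW// truncnS_gt.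
  near=> k; rewrite /r; case: pselect => [ex|_]; last first.
    by rewrite (le_trans AM)// ler_nat; near: k; exact: nbhs_infty_ge.
  case: cid => N /= fN; have [_ + _] := fP N; apply: le_trans.
  rewrite (le_trans AM)// ler_nat leqNgt; apply/negP => NM.
  (* An index beyond this sum differs from those of the first [M] counterexamples, so the one chosen
     for it has [N >= M]. *)
  suff : (\sum_(i < M) (f i).1 < k)%N.
    by rewrite -fN (bigD1 (Ordinal NM))//= ltnNge leq_addr.
  by near: k; exact: nbhs_infty_gt.
have /fine_cvgP[fin /cvgrPdist_le/(_ _ e0)] := far r roo.
case: fin => N1 _ fin [N2 _ lim].
pose k := (f (maxn N1 N2)).1.
have [Nk _ _] := fP (maxn N1 N2).
have {Nk} [N1k N2k] : (N1 <= k)%N /\ (N2 <= k)%N.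
  by move: Nk; rewrite -/k geq_max => /andP.
have := lim k N2k; have := fin k N1k; rewrite /= /r.
case: pselect => [ex|[]]; last by exists (maxn N1 N2).
case: cid => N /= fN finW; have [_ _ bW] := fP N; move: bW; rewrite fN.
rewrite -(fineK finW) /= !lee_fin => bW dW; apply: bW.
by rewrite ler_distlC in dW.
Unshelve. all: by end_near.
Qed.

(** Since [cf] is nonincreasing from index 1 on, [W k] and [Wbar k] agree beyond [1 + cf 1] for all
    [k >= 1] at once. *)
Lemma far_potential (R : realType) (cf : nat -> R) (W Wbar : nat -> R -> \bar R)
    (W0 : R -> R) (omega : R) :
  threshold cf -> pair_potential cf W Wbar W0 -> far_limit Wbar omega ->
  forall e : R, 0 < e -> exists N : nat, forall k r, (N <= k)%N -> N%:R <= r ->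
      ((omega - e)%:E <= k%:R%:E * W k r <= (omega + e)%:E)%E.
Proof.
move=> [cf_mono _ _] hW far e e0.
have [N NP] := far_limit_uniform far e0.
pose M := (maxn N (Num.truncn (1 + cf 1%N))).+1.
exists M => k r Mk Mr.
have k0 : (0 < k)%N by apply: leq_trans Mk.
have cfk : cf k <= cf 1%N.
  case: k k0 {Mk} => // k _; elim: k => // k; apply: le_trans; exact: cf_mono.
have rcf : 1 + cf k <= r.
  rewrite (le_trans _ Mr)// (le_trans (lerD (lexx 1) cfk))// ltW//.
  by rewrite (lt_le_trans (truncnS_gt _))// ler_nat ltnS leq_maxr.
have r0 : 0 <= r by apply: le_trans Mr.
rewrite (pp_far hW k0 r0); last by right.
apply: NP.
  by rewrite (leq_trans _ Mk)// /M ltnW// ltnS leq_maxl.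
by rewrite (le_trans _ Mr)// ler_nat /M ltnW// ltnS leq_maxl.
Qed.

Lemma fsume_const (R : realType) (I : choiceType) (P : set I) (c : R) :
  finite_set P -> (\sum_(p \in P) c%:E = (#|` fset_set P|%:R * c)%:E)%E.
Proof.
move=> finP; rewrite fsbig_finite// sumEFin big_const_seq count_predT iter_addr_0.
by rewrite mulr_natl.
Qed.

(** The two fibres that the zigzag chain of [p] visits at layers [m] and [m + 1]. For [p = (q, q)]
    the chain is the fibre over [q], so axial and diagonal bonds can be treated together. *)
Definition swap_odd (T : Type) (m : int) (p : T * T) : T * T :=
  if odd `|m| then (p.2, p.1) else p.

Lemma odd_absz_succ (m : int) : odd `|m + 1| = ~~ odd `|m|.
Proof. by case: m => n; lia. Qed.

Lemma swap_oddS (T : Type) (m : int) (p : T * T) :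
  (swap_odd (m + 1) p).1 = (swap_odd m p).2.
Proof. by rewrite /swap_odd odd_absz_succ; case: odd. Qed.

(* The bonds between consecutive layers split into zigzag chains, one through
   each pair [p]; every chain contributes at least one large term. *)
Lemma zigzag_sum_ge (R : realType) (S : set 'cV[R]_2) h (M : set int)
    (F : int -> 'cV[R]_2 * 'cV[R]_2 -> \bar R) (c : R) :
  finite_set (bond_pairs S h) -> finite_set M ->
  (forall m p, (0 <= F m p)%E) ->
  (forall p, bond_pairs S h p -> exists2 m, M m & (c%:E <= F m (swap_odd m p))%E) ->
  ((#|` fset_set (bond_pairs S h)|%:R * c)%:E
    <= \sum_(m \in M) \sum_(p \in bond_pairs S h) F m p)%E.
Proof.
move=> finP finM F0 ex.
have -> : (\sum_(m \in M) \sum_(p \in bond_pairs S h) F m p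
    = \sum_(m \in M) \sum_(p \in bond_pairs S h) F m (swap_odd m p))%E.
  apply: eq_fsbigr => m _; apply: (reindex_fsbig (swap_odd m)); split.
  - by move=> [p q] Ppq; rewrite /swap_odd; case: odd => //; exact: bond_pairs_swap.
  - by move=> [p q] [p' q'] _ _; rewrite /swap_odd; case: odd => // -[-> ->].
  - move=> [p q] Ppq; rewrite /swap_odd; case: odd; last by exists (p, q).
    by exists (q, p) => //; exact: bond_pairs_swap.
rewrite exchange_fsbig// -fsume_const//; apply: lee_fsum => // p Pp.
have [m Mm cm] := ex p Pp; rewrite (le_trans cm)//.
by rewrite (fsbigD1 m)// leeDl// fsume_ge0.
Qed.

Lemma entry_le_enorm (R : realType) m n (A : 'M[R]_(m, n)) i j : `|A i j| <= enorm A.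
Proof.
rewrite -[leLHS]sqrtr_sqr ler_sqrt; last by do 2!apply: sumr_ge0 => ? _; exact: sqr_ge0.
rewrite (bigD1 i)//= (bigD1 j)//= -addrA lerDl addr_ge0// sumr_ge0// => ? _.
  exact: sqr_ge0.
by apply: sumr_ge0 => ? _; exact: sqr_ge0.
Qed.

Lemma long_step (R : realType) (f : nat -> R) (N : nat) (l : R) :
  (0 < N)%N -> N%:R * l <= `|f N - f 0%N| ->
  exists2 j, (j < N)%N & l <= `|f j - f j.+1|.
Proof.
case: N => // N _ lN; apply: contrapT => nol.
have lt j : (j < N.+1)%N -> `|f j.+1 - f j| < l.
  by move=> jN; rewrite distrC ltNge; apply/negP => lj; apply: nol; exists j.
move: lN; apply/negP; rewrite -ltNge -(telescope_sumr f (leq0n N.+1)).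
rewrite (le_lt_trans (ler_norm_sum _ _ _))// big_mkord.
rewrite mulr_natl -[in ltRHS](card_ord N.+1) -sumr_const.
rewrite !big_ord_recl; apply: ltr_leD.
  exact: lt.
by apply: ler_sum => i _; apply/ltW/lt.
Qed.

Lemma limn_esup_ge (R : realType) (u : nat -> \bar R) (c : R) :
  (forall e : R, 0 < e -> \forall n \near \oo, ((c - e)%:E <= u n)%E) ->
  (c%:E <= limn_esup u)%E.
Proof.
move=> uc; apply/lee_subgt0Pr => e e0; rewrite limn_esup_lim.
rewrite (cvg_lim _ (@cvg_esups_inf R u))//; apply: le_ereal_inf_tmp => _ [n _ <-].
have [N _ NP] := uc e e0.
apply: (@le_trans _ _ (u (maxn n N))); first exact: (NP _ (leq_maxr _ _)).
by apply: ereal_sup_ubound; exists (maxn n N) => //=; exact: leq_maxl.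
Qed.

Lemma cvg_entry (R : realType) m n (A : nat -> 'M[R]_(m.+1, n.+1)) (B : 'M[R]_(m.+1, n.+1)) i j :
  A k @[k \oo] --> B -> A k i j @[k \oo] --> B i j.
Proof.
move=> /cvgrPdist_le AB; apply/cvgrPdist_le => e e0.
apply: filterS (AB e e0) => k; apply: le_trans.
by rewrite -oppmxE -addmxE; exact: entry_le_norm.
Qed.

Lemma SO3_entry (R : realType) (Q : 'M[R]_3) i j : SO3 Q -> `|Q i j| <= 1.
Proof.
move=> [/matrixP/(_ j j) QQ _]; move: QQ; rewrite !mxE eqxx mulr1n => QQ.
rewrite -(ler_sqr (normr_ge0 _) ler01) expr1n real_normK ?num_real// -QQ.
rewrite (bigD1 i)//= mxE -expr2 lerDl sumr_ge0// => k _.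
by rewrite mxE -expr2 sqr_ge0.
Qed.

Lemma ptE0 (R : realType) (s : R) (x : 'cV[R]_2) : pt s x 0 0 = s.
Proof.
rewrite /pt mxE; case: splitP => [j _|j]; last by move=> /eqP.
by rewrite (ord1 j) mxE eqxx mulr1n.
Qed.

Lemma ptES (R : realType) (s : R) (x : 'cV[R]_2) (a : 'I_3) (b : 'I_2) :
  a = b.+1 :> nat -> pt s x a 0 = x b 0.
Proof.
move=> ab; rewrite /pt mxE; case: splitP => [j aj|j].
  by move: aj; rewrite ab (ord1 j).
by rewrite ab => -[/val_inj ->].
Qed.

Lemma sum_ord3 (V : nmodType) (F : 'I_3 -> V) :
  \sum_i F i = F 0 + F 1 + F (inord 2).
Proof.
rewrite !big_ord_recl big_ord0 addr0 addrA.
by congr (_ + F _ + F _); apply: val_inj; rewrite /= ?inordK.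
Qed.

Lemma rotation_entry_bound (R : realType) (Q : 'M[R]_3) (s : R) (x : 'cV[R]_2) a :
  SO3 Q -> `|(Q *m pt s x) a 0| <= `|s| + `|x 0 0| + `|x 1 0|.
Proof.
move=> SOQ; rewrite mxE sum_ord3 ptE0 (@ptES _ _ _ 1 0)// (@ptES _ _ _ (inord 2) 1) ?inordK//.
rewrite (le_trans (ler_normD _ _))// lerD//.
  rewrite (le_trans (ler_normD _ _))// lerD// normrM ler_piMl ?SO3_entry//.
by rewrite normrM ler_piMl ?SO3_entry.
Qed.

Lemma mesh_gt0 (R : realType) (r : R) k : 0 < r -> (0 < k)%N -> 0 < mesh r k.
Proof. by move=> r0 k0; rewrite invr_gt0 mulr_gt0 ?ltr0n. Qed.

Lemma finite_entry_bound (R : realType) (A : set 'cV[R]_2) : finite_set A ->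
  exists2 B : R, 0 <= B & forall p, A p -> forall a, `|p a 0| <= B.
Proof.
move=> finA; exists (\sum_(p \in A) `|p|); first exact: fsumr_ge0.
move=> p Ap a; rewrite (le_trans (entry_le_norm _ _ _))//.
by rewrite (fsbigD1 p)//= lerDl fsumr_ge0.
Qed.

(** The chain is followed in the single coordinate [a] through the [2 K] bonds from layer [-K] to
    layer [K]. Its ends lie in the rigid parts, where [v] differs from [cm] or [cp] by at most
    [r + 2 B / k]; so in atomic units they are at least [2 r k l >= 2 K l] apart, and some step has
    length at least [l]. *)
Lemma long_bond (R : realType) (S : set 'cV[R]_2) (r : R) (k : nat)
    (v : 'cV[R]_3 -> 'cV[R]_3) (Qp Qm : 'M[R]_3) (cp cm : 'cV[R]_3) (B l : R) a h p :
  0 < r -> (0 < k)%N -> 4 <= r * k%:R -> SO3 Qp -> SO3 Qm ->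
  rigid_on S `[3 / 4, 1] r k v Qp cp -> rigid_on S `[- 1, - (3 / 4)] r k v Qm cm ->
  (forall q, lattice S q -> forall b, `|q b 0| <= B) ->
  0 <= l -> 2 * r * l <= `|(cp - cm) a 0| - 2 * (r + 2 * B / k%:R) ->
  bond_pairs S h p ->
  exists2 m, layers (mesh r k) m & l <= bond r k v m (swap_odd m p).
Proof.
move=> r0 k0 rk SOp SOm rigp rigm qB l0 lle Pp.
have kR : (0 : R) < k%:R by rewrite ltr0n.
have h0 : 0 < mesh r k by exact: mesh_gt0.
have hrk : mesh r k * (r * k%:R) = 1 by rewrite /mesh mulVf// gt_eqF// mulr_gt0.
have h4 : mesh r k <= 4^-1 by rewrite /mesh lef_pV2 ?posrE// mulr_gt0.
(* With the mesh [h <= 1/4] this gives [1 - h < K h <= 1], so that [K h] lies in [3/4, 1]. *)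
pose K := Num.truncn (r * k%:R).
have /andP[K1 K2] : K%:R <= r * k%:R < K.+1%:R.
  by apply: truncn_itv; rewrite mulr_ge0// ltW.
have Kh1 : K%:R * mesh r k <= 1 by rewrite -[leRHS]hrk mulrC ler_pM2l.
have Kh2 : 3 / 4 <= K%:R * mesh r k.
  have : (r * k%:R) * mesh r k < K.+1%:R * mesh r k by rewrite ltr_pM2r.
  rewrite mulrC hrk -addn1 natrD mulrDl mul1r; lra.
have K0 : (0 < K)%N by rewrite /K truncn_gt0; lra.
have LSw m : lattice S (swap_odd m p).1.
  by rewrite /swap_odd; case: odd; case: Pp.
have atomK s q (Q : 'M[R]_3) c : SO3 Q -> lattice S q -> `|s| <= 1 ->
    v (pt s q) = Q *m pt (r * s) (k%:R^-1 *: q) + c ->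
    `|v (pt s q) a 0 - c a 0| <= r + 2 * B / k%:R.
  move=> SOQ Lq s1 ->; rewrite linmxE addrK.
  rewrite (le_trans (rotation_entry_bound _ _ _ SOQ))// !linmxE -addrA lerD//.
    by rewrite normrM gtr0_norm// ler_piMr// ltW.
  rewrite !normrM (gtr0_norm (_ : 0 < k%:R^-1)) ?invr_gt0//.
  have -> : 2 * B / k%:R = k%:R^-1 * B + k%:R^-1 * B by ring.
  by rewrite lerD// ler_pM2l ?invr_gt0// qB.
pose m0 : int := - K%:Z.
pose f (j : nat) := atom r k v (m0 + j%:Z) (swap_odd (m0 + j%:Z) p).1 a 0.
have [||j jN lj] := @long_step R f (2 * K) l.
- by rewrite muln_gt0.
- have e0 : m0 + 0%:Z = - K%:Z by rewrite addr0.
  have eN : m0 + (2 * K)%N%:Z = K%:Z by rewrite /m0; clear; lia.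
  have s0 : `|(- K%:Z)%:~R * mesh r k| <= 1.
    by rewrite mulrNz mulNr normrN gtr0_norm// mulr_gt0// ltr0n.
  have sN : `|K%:Z%:~R * mesh r k| <= 1 by rewrite gtr0_norm// mulr_gt0// ltr0n.
  rewrite /f e0 eN /atom !linmxE -mulrBr normrM gtr0_norm//.
  set q0 := (swap_odd (- K%:Z) p).1; set qN := (swap_odd K%:Z p).1.
  have L0 : lattice S q0 by exact: LSw.
  have LN : lattice S qN by exact: LSw.
  have I0 : `[- 1, - (3 / 4)]%classic ((- K%:Z)%:~R * mesh r k).
    by rewrite /= in_itv/= mulrNz mulNr; apply/andP; split; lra.
  have IN : `[3 / 4, 1]%classic (K%:Z%:~R * mesh r k).
    by rewrite /= in_itv/=; apply/andP.
  have := atomK _ q0 _ cm SOm L0 s0 (rigm _ _ I0 (lattice_closure_Sext L0)).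
  have := atomK _ qN _ cp SOp LN sN (rigp _ _ IN (lattice_closure_Sext LN)).
  set vN := v _ a 0; set v0 := v _ a 0 => dN d0.
  apply: (@le_trans _ _ (k%:R * (2 * r * l))).
    rewrite natrM -!mulrA [leRHS]mulrCA ler_pM2l// !mulrA ler_wpM2r//.
    by rewrite mulrC.
  rewrite ler_pM2l//; apply: (le_trans lle).
  have : `|(cp - cm) a 0| <= `|vN - cp a 0| + `|vN - v0| + `|v0 - cm a 0|.
    rewrite !linmxE.
    have -> : cp a 0 - cm a 0 = - (vN - cp a 0) + (vN - v0) + (v0 - cm a 0) by ring.
    by rewrite (le_trans (ler_normD _ _))// lerD2r (le_trans (ler_normD _ _))// normrN.
  by move: dN d0; clear; lra.
exists (m0 + j%:Z).
  rewrite /layers/= /m0 intrD mulrNz.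
  have jh : 0 <= j%:R * mesh r k by rewrite mulr_ge0// ltW.
  have jh2 : j.+1%:R * mesh r k <= (2 * K)%:R * mesh r k.
    by rewrite ler_pM2r// ler_nat.
  move: jh2; rewrite -addn1 natrD natrM !mulrDl mulNr => jh2.
  by apply/andP; split; rewrite -[j%:Z%:~R]/(j%:R); lra.
apply: (le_trans lj); rewrite /bond -swap_oddS -addrA.
have -> : j%:Z + 1 = j.+1%:Z by rewrite -addn1 PoszD.
by rewrite /f -oppmxE -addmxE entry_le_enorm.
Qed.

(** * Lower bound *)

Section LowerBound.
Variables (R : realType) (S L' : set 'cV[R]_2) (cf : nat -> R).
Variables (WNN WNNN WbarNN WbarNNN : nat -> R -> \bar R) (W0NN W0NNN : R -> R).
Variable chi : nat -> 'M[R]_(3, 8) -> R.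
Variables omegaNN omegaNNN : R.
Hypothesis hS : cross_section S L'.
Hypothesis hcf : threshold cf.
Hypothesis hNN : pair_potential cf WNN WbarNN W0NN.
Hypothesis hNNN : pair_potential cf WNNN WbarNNN W0NNN.
Hypothesis hchi : orientation_penalty chi.
Hypothesis hfarNN : far_limit WbarNN omegaNN.
Hypothesis hfarNNN : far_limit WbarNNN omegaNNN.

Local Notation W := (Wtot L' (Wcell WNN WNNN chi) (Wsurf S WNN WNNN)).
Local Notation nb h := (#|` fset_set (bond_pairs S h)|%:R : R).

Lemma scaled_energy_ge r k v (l c1 c2 : R) : 0 < r -> (0 < k)%N ->
  (forall h p, bond_pairs S h p ->
    exists2 m, layers (mesh r k) m & l <= bond r k v m (swap_odd m p)) ->
  (forall s, l <= s -> (c1%:E <= k%:R%:E * WNN k s)%E) ->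
  (forall s, l <= s -> (c2%:E <= k%:R%:E * WNNN k (s / Num.sqrt 2)%R)%E) ->
  ((nb 1 * c1 + nb 2 * c2)%:E <= scaled_energy L' W r k v)%E.
Proof.
move=> r0 k0 ex hc1 hc2.
rewrite (scaled_energy_bonds hS hNN hNNN hchi)//.
have finM := finite_layers (mesh_gt0 r0 k0).
have finP h := finite_bond_pairs hS h.
have WNN0 m p : (0 <= WNN k (bond r k v m p))%E.
  by apply: (WNN_ge0 hNN) => //; exact: enorm_ge0.
have WNNN0 m p : (0 <= WNNN k (bond r k v m p / Num.sqrt 2)%R)%E.
  by apply: (WNNN_ge0 hNNN) => //; exact: enorm_ge0.
have kR : (0 <= k%:R%:E :> \bar R)%E by rewrite lee_fin.
rewrite EFinD; apply: (@le_trans _ _ (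
   \sum_(m \in layers (mesh r k)) \sum_(p \in bond_pairs S 1)
     (k%:R%:E * WNN k (bond r k v m p))
   + \sum_(m \in layers (mesh r k)) \sum_(p \in bond_pairs S 2)
     (k%:R%:E * WNNN k (bond r k v m p / Num.sqrt 2)%R))%E).
  apply: leeD; apply: zigzag_sum_ge => // [m p|p /ex[m Mm lm]].
  - exact: mule_ge0.
  - by exists m => //; exact: hc1.
  - exact: mule_ge0.
  - by exists m => //; exact: hc2.
rewrite -fsume_split//; apply: lee_fsum => // m _.
rewrite -!ge0_mule_fsumr// -ge0_muleDr ?fsume_ge0//.
rewrite lee_wpmul2l// leeDl// fsume_ge0// => x' _.
exact: (horizontal_energy_ge0 S L' hNN hNNN hchi _ _ k0).
Qed.

Lemma long_bonds_near (yp ym : 'cV[R]_3) (Rp Rm : 'M[R]_3) r k v (A : R) :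
  transition_sequences S L' yp ym Rp Rm r k v -> yp != ym ->
  \forall n \near \oo, forall h p, bond_pairs S h p ->
    exists2 m, layers (mesh (r n) (k n)) m
      & A <= bond (r n) (k n) (v n) m (swap_odd m p).
Proof.
move=> [rkv [rdecr rlim] rklim [Rpn [Rmn [ypn [ymn [SOpm _ [yplim ymlim] rig]]]]]] ypm.
have [a ya] : exists a, (yp - ym) a 0 != 0.
  apply: contrapT => no; move: ypm; rewrite -subr_eq0 => /eqP; apply.
  apply/matrixP => a b; rewrite (ord1 b) [RHS]mxE.
  by apply: contrapT => /eqP ne; apply: no; exists a.
have d0 : 0 < `|(yp - ym) a 0| by rewrite normr_gt0.
set d := `|(yp - ym) a 0| in d0.
have [B B0 qB] := finite_entry_bound (finite_lattice hS).
have Xlim : (ypn n - ymn n) a 0 @[n \oo] --> (yp - ym) a 0.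
  by apply: cvg_entry; exact: cvgB.
pose l := Num.max A 0.
have l0 : 0 <= l by rewrite le_max lexx orbT.
have Al : A <= l by rewrite le_max lexx.
(* For [r] below this bound and [2 B / k <= d / 16], one has [2 r l + 2 r + 4 B / k <= 3 d / 16],
   well below the [3 d / 4] that remains of the jump. *)
have e1 : 0 < d / (32 * (l + 1)).
  by rewrite divr_gt0// mulr_gt0// ltr_wpDl.
near=> n; move=> h p Pp.
have [r0 k0 _] := rkv n.
have [rigp rigm] := rig n; have [SOp SOm] := SOpm n.
have rk4 : 4 <= r n * (k n)%:R.
  by near: n; move/cvgryPge : rklim; exact.
have Xn : `|(ypn n - ymn n) a 0| >= d - d / 4.
  have : `|(yp - ym) a 0 - (ypn n - ymn n) a 0| <= d / 4.
    by near: n; move/cvgrPdist_le : Xlim; apply; rewrite divr_gt0.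
  by have := lerB_dist ((yp - ym) a 0) ((ypn n - ymn n) a 0); rewrite -/d; lra.
have rn : r n <= d / (32 * (l + 1)).
  have : `|0 - r n| <= d / (32 * (l + 1)).
    by near: n; move/cvgrPdist_le : rlim; exact.
  by rewrite sub0r normrN gtr0_norm.
(* As [r] is nonincreasing, [r n * k n <= r 0 * k n], so [k n] tends to infinity. *)
have kn : 2 * B / (k n)%:R <= d / 16.
  have kR : (0 : R) < (k n)%:R by rewrite ltr0n.
  rewrite ler_pdivrMr//.
  have : r 0%N * (32 * B / d) <= r n * (k n)%:R.
    by near: n; move/cvgryPge : rklim; exact.
  have rn0 : r n <= r 0%N by exact: rdecr.
  have r00 : 0 < r 0%N by have [] := rkv 0%N.
  move=> h1; have : r 0%N * (32 * B / d) <= r 0%N * (k n)%:R.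
    by apply: (le_trans h1); rewrite ler_wpM2r// ltW.
  rewrite ler_pM2l// ler_pdivrMr// => h2; lra.
have rl : r n * (32 * (l + 1)) <= d by rewrite -ler_pdivlMr// mulr_gt0// ltr_wpDl.
have rll : 0 <= r n * l by rewrite mulr_ge0// ltW.
have [m Mm lm] := @long_bond R S (r n) (k n) (v n) (Rpn n) (Rmn n) (ypn n) (ymn n)
    B l a h p r0 k0 rk4 SOp SOm rigp rigm qB l0 ltac:(lra) Pp.
by exists m => //; exact: le_trans lm.
Unshelve. all: by end_near.
Qed.

Lemma k_near (yp ym : 'cV[R]_3) (Rp Rm : 'M[R]_3) r k v (N : nat) :
  transition_sequences S L' yp ym Rp Rm r k v -> \forall n \near \oo, (N <= k n)%N.
Proof.
move=> [rkv [rdecr _] rklim _].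
have r00 : 0 < r 0%N by have [] := rkv 0%N.
near=> n; rewrite -(ler_nat R) -(ler_pM2l r00).
have : r 0%N * N%:R <= r n * (k n)%:R by near: n; move/cvgryPge : rklim; exact.
by move=> /le_trans; apply; rewrite ler_wpM2r// rdecr.
Unshelve. all: by end_near.
Qed.

Lemma limit_energy_ge (yp ym : 'cV[R]_3) (Rp Rm : 'M[R]_3) r k v :
  transition_sequences S L' yp ym Rp Rm r k v -> yp != ym ->
  ((nb 1 * omegaNN + nb 2 * omegaNNN)%:E
    <= limn_esup (fun n => scaled_energy L' W (r n) (k n) (v n)))%E.
Proof.
move=> ts ypm; apply: limn_esup_ge => e e0.
pose d := e / (nb 1 + nb 2 + 1).
have nb0 : (0 : R) < nb 1 + nb 2 + 1 by rewrite ltr_wpDl// addr_ge0.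
have d0 : 0 < d by rewrite divr_gt0.
have [N1 far1] := far_potential hcf hNN hfarNN d0.
have [N2 far2] := far_potential hcf hNNN hfarNNN d0.
(* The factor [sqrt 2] compensates the division of the length in the argument of [WNNN]. *)
pose l := Num.max (N1%:R) (N2%:R * Num.sqrt 2) : R.
have long := long_bonds_near l ts ypm.
have k1 := k_near N1 ts; have k2 := k_near N2 ts.
have [rkv _ _ _] := ts.
near=> n; have [r0 k0 _] := rkv n.
apply: (@le_trans _ _ (nb 1 * (omegaNN - d) + nb 2 * (omegaNNN - d))%:E).
  rewrite lee_fin.
  have : (nb 1 + nb 2) * d <= e.
    rewrite /d mulrA ler_pdivrMr// mulrC ler_pM2l//; lra.
  by lra.
apply: (@scaled_energy_ge _ _ _ l) => //.
- by near: n.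
- move=> s ls; have N1k : (N1 <= k n)%N by near: n.
  have N1s : N1%:R <= s by rewrite (le_trans _ ls)// le_max lexx.
  by have /andP[] := far1 _ _ N1k N1s.
- move=> s ls; have N2k : (N2 <= k n)%N by near: n.
  have N2s : N2%:R <= s / Num.sqrt 2.
    by rewrite ler_pdivlMr ?sqrtr_gt0// (le_trans _ ls)// le_max lexx orbT.
  by have /andP[] := far2 _ _ N2k N2s.
Unshelve. all: by end_near.
Qed.

End LowerBound.

(** * Piecewise affine interpolation on a block *)

Section BlockInterpolation.
Variables (R : realType) (h w : R) (x' : 'cV[R]_2).
Hypothesis h0 : 0 < h.

Let p (i : 'I_8) : 'cV[R]_3 := pt (corner h w x' i).1 (corner h w x' i).2.
Let face (a : 'I_3) (i j : 'I_8) := Idbar R a j == Idbar R a i.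
Let face_centre (a : 'I_3) (i : 'I_8) : 'cV[R]_3 := 4^-1 *: \sum_(j | face a i j) p j.
Let simplex a i j : 4.-tuple 'cV[R]_3 := [tuple pt w x'; face_centre a i; p i; p j].

(* The scalar version of the conditions that [PAff] imposes on one block. *)
Definition block_interp (s : 'cV[R]_3 -> R) : Prop :=
  [/\ s (pt w x') = 8^-1 * \sum_i s (p i),
      forall a i, s (face_centre a i) = 4^-1 * \sum_(j | face a i j) s (p j)
    & forall a i j, face a i j -> enorm (z R i - z R j) = 1 ->
        forall t : 'I_4 -> R, (forall l, 0 <= t l) -> \sum_l t l = 1 ->
          s (\sum_l t l *: tnth (simplex a i j) l)
          = \sum_l t l * s (tnth (simplex a i j) l)].

(* Coordinates in which the block is the cube [-1/2, 1/2]^3. *)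
Definition block_coord (c : 'I_3) (X : 'cV[R]_3) : R :=
  if c == 0 then (X 0 0 - w) / h else X c 0 - pt w x' c 0.

Definition in_block (X : 'cV[R]_3) : Prop := forall c, `|block_coord c X| <= 2^-1.

Lemma faceE a i j : face a i j = (cbit a j == cbit a i).
Proof.
rewrite /face !IdbarE (inj_eq (addIr _)).
by case: cbit; case: cbit; rewrite ?eqxx//= ?oner_eq0// eq_sym oner_eq0.
Qed.

(** Replaces the numbering of the corners by their bits, after which sums over a face can be
    evaluated. *)
Lemma sum_face (F : nat -> nat -> nat -> R) a i :
  \sum_(j | face a i j) F (cbit 0 j) (cbit 1 j) (cbit 2 j) =
  \sum_(b0 < 2) \sum_(b1 < 2) \sum_(b2 < 2)
    if nth 0%N [:: b0 : nat; b1 : nat; b2 : nat] a == cbit a i then F b0 b1 b2 else 0.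
Proof.
rewrite big_mkcond (eq_bigr (fun j : 'I_8 => if cbit a j == cbit a i then
  F (cbit 0 j) (cbit 1 j) (cbit 2 j) else 0)); last by move=> j _; rewrite faceE.
rewrite !big_ord_recl !big_ord0 /=.
case: a => [[|[|[|//]]] ?] /=; case: (cbit _ i) => /=; ring.
Qed.

Lemma sum_cube (F : nat -> nat -> nat -> R) :
  \sum_(j < 8) F (cbit 0 j) (cbit 1 j) (cbit 2 j) =
  \sum_(b0 < 2) \sum_(b1 < 2) \sum_(b2 < 2) F b0 b1 b2.
Proof. by rewrite !big_ord_recl !big_ord0 /=; ring. Qed.

Lemma pt_corner_coord c i : block_coord c (p i) = (cbit c i)%:R - 2^-1.
Proof.
rewrite /block_coord /p /corner/=; case: eqP => [->|c0].
  by rewrite ptE0 z1E; field; rewrite gt_eqF.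
have [b cb] : exists b : 'I_2, c = b.+1 :> nat.
  case: c c0 => [[|[|[|//]]] ic] c0; [by case: c0; exact: val_inj|by exists 0|by exists 1].
by rewrite !(ptES _ _ cb) linmxE z'E -cb; ring.
Qed.

Lemma block_coord_centre c : block_coord c (pt w x') = 0.
Proof.
by rewrite /block_coord; case: eqP => _; rewrite ?ptE0 subrr// mul0r.
Qed.

Lemma block_coord_sum (I : finType) (P : pred I) (t : I -> R) (q : I -> 'cV[R]_3) c :
  \sum_(l | P l) t l = 1 ->
  block_coord c (\sum_(l | P l) t l *: q l) = \sum_(l | P l) t l * block_coord c (q l).
Proof.
move=> t1; rewrite /block_coord; case: eqP => _.
  under [in RHS]eq_bigr do rewrite mulrA mulrBr.
  rewrite -mulr_suml sumrB -mulr_suml t1 mul1r summxE.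
  by under eq_bigr do rewrite linmxE.
under [in RHS]eq_bigr do rewrite mulrBr.
rewrite sumrB -mulr_suml t1 mul1r summxE.
by under eq_bigr do rewrite linmxE.
Qed.

Lemma sum_face_quarter a i : \sum_(j | face a i j) (4^-1 : R) = 1.
Proof.
rewrite (sum_face (fun _ _ _ => 4^-1)) !big_ord_recl !big_ord0.
by case: a => [[|[|[|//]]] ?] /=; case: (cbit _ i) => //=; rewrite /bump/=; field.
Qed.

Lemma face_centreE a i : face_centre a i = \sum_(j | face a i j) 4^-1 *: p j.
Proof. by rewrite /face_centre scaler_sumr. Qed.

Lemma block_coord_face c a i :
  block_coord c (face_centre a i) = if c == a then (cbit a i)%:R - 2^-1 else 0.
Proof.
rewrite face_centreE block_coord_sum ?sum_face_quarter//.
under eq_bigr do rewrite pt_corner_coord.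
have -> : \sum_(j | face a i j) 4^-1 * ((cbit c j)%:R - 2^-1 : R) =
    \sum_(j | face a i j)
      4^-1 * ((nth 0%N [:: cbit 0 j : nat; cbit 1 j : nat; cbit 2 j : nat] c)%:R - 2^-1).
  by apply: eq_bigr => j _; case: c => [[|[|[|//]]] ?].
rewrite (sum_face (fun b0 b1 b2 => 4^-1 * ((nth 0%N [:: b0; b1; b2] c)%:R - 2^-1))).
rewrite !big_ord_recl !big_ord0.
by case: c => [[|[|[|//]]] ?]; case: a => [[|[|[|//]]] ?] /=; rewrite -?val_eqE/=;
  case: (cbit _ i) => //=; rewrite /bump/=; field.
Qed.

Lemma in_block_sum (I : finType) (t : I -> R) (q : I -> 'cV[R]_3) :
  (forall l, 0 <= t l) -> \sum_l t l = 1 -> (forall l, in_block (q l)) ->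
  in_block (\sum_l t l *: q l).
Proof.
move=> t0 t1 qb c; rewrite block_coord_sum// (le_trans (ler_norm_sum _ _ _))//.
rewrite -[leRHS]mul1r -[X in _ <= X * _]t1 mulr_suml; apply: ler_sum => l _.
rewrite normrM ger0_norm// ler_wpM2l//; exact: qb.
Qed.

Lemma half_bit_norm (b : bool) : `|b%:R - 2^-1 : R| <= 2^-1.
Proof.
case: b => /=; last by rewrite sub0r normrN ger0_norm.
by rewrite ger0_norm; lra.
Qed.

Lemma in_block_corner i : in_block (p i).
Proof. by move=> c; rewrite pt_corner_coord half_bit_norm. Qed.

Lemma in_block_simplex a i j l : in_block (tnth (simplex a i j) l).
Proof.
case: l => [[|[|[|[|//]]]] il] c; rewrite (tnth_nth 0)/=.
- by rewrite block_coord_centre normr0.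
- rewrite block_coord_face; case: ifP => _; last by rewrite normr0.
  exact: half_bit_norm.
- exact: in_block_corner.
- exact: in_block_corner.
Qed.

(** All points at which the conditions are tested lie in the block, which is convex. A map given by
    cases may thus be replaced, block by block, by one formula. *)
Lemma eq_block_interp (s s' : 'cV[R]_3 -> R) :
  (forall X, in_block X -> s X = s' X) -> block_interp s' -> block_interp s.
Proof.
move=> ss' [s1 s2 s3]; split.
- rewrite ss'; last by move=> c; rewrite block_coord_centre normr0.
  by rewrite s1; congr (_ * _); apply: eq_bigr => i _; rewrite ss'//; exact: in_block_corner.
- move=> a i; rewrite ss'; last exact: (in_block_simplex a i i 1).
  by rewrite s2; congr (_ * _); apply: eq_bigr => j _; rewrite ss'//; exact: in_block_corner.
- move=> a i j fij zij t t0 t1.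
  rewrite ss'; last by apply: in_block_sum => // l; exact: in_block_simplex.
  by rewrite s3//; apply: eq_bigr => l _; rewrite ss'//; exact: in_block_simplex.
Qed.

(** The conditions are linear in [s], so they need checking only for constants, coordinates and
    [cross]. *)
Lemma block_interpD s s' : block_interp s -> block_interp s' ->
  block_interp (fun X => s X + s' X).
Proof.
move=> [s1 s2 s3] [t1 t2 t3]; split.
- by rewrite s1 t1 big_split mulrDr.
- by move=> a i; rewrite s2 t2 big_split mulrDr.
- move=> a i j fij zij t t0 tE; rewrite s3// t3// -big_split.
  by apply: eq_bigr => l _; rewrite mulrDr.
Qed.

Lemma block_interpZ c s : block_interp s -> block_interp (fun X => c * s X).
Proof.
move=> [s1 s2 s3]; split.
- by rewrite s1 -mulr_sumr mulrCA.
- by move=> a i; rewrite s2 -mulr_sumr mulrCA.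
- move=> a i j fij zij t t0 tE; rewrite s3// mulr_sumr.
  by apply: eq_bigr => l _; rewrite mulrCA.
Qed.

Lemma block_interp_cst c : block_interp (fun=> c).
Proof.
split.
- by rewrite (sum_cube (fun _ _ _ => c)) !big_ord_recl !big_ord0 /=; field.
- by move=> a i; rewrite mulr_sumr -mulr_suml sum_face_quarter mul1r.
- by move=> a i j _ _ t _ t1; rewrite -mulr_suml t1 mul1r.
Qed.

Lemma block_interp_coord c : block_interp (block_coord c).
Proof.
split.
- rewrite block_coord_centre; under eq_bigr do rewrite pt_corner_coord.
  rewrite !big_ord_recl !big_ord0.
  by case: c => [[|[|[|//]]] ?] /=; field.
- move=> a i; rewrite face_centreE block_coord_sum ?sum_face_quarter//.
  by rewrite mulr_sumr.
- by move=> a i j _ _ t _ t1; rewrite block_coord_sum.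
Qed.

(* Coincides with [a * b] at the corners of the square [-1/2, 1/2]^2 and vanishes
   on its two axes. *)
Definition cross (a b : R) : R := (`|a + b| - `|a - b|) / 4.

Lemma cross0l b : cross 0 b = 0.
Proof. by rewrite /cross add0r sub0r normrN subrr mul0r. Qed.

Lemma cross0r a : cross a 0 = 0.
Proof. by rewrite /cross addr0 subr0 subrr mul0r. Qed.

Lemma cross_corner (b1 b2 : bool) :
  cross (b1%:R - 2^-1) (b2%:R - 2^-1) = (b1%:R - 2^-1) * (b2%:R - 2^-1).
Proof.
rewrite /cross; case: b1; case: b2 => /=.
- rewrite subrr normr0 ger0_norm; lra.
- rewrite (_ : 1%:R - 2^-1 + (0%:R - 2^-1) = 0) ?normr0 ?ger0_norm; lra.
- rewrite (_ : 0%:R - 2^-1 + (1%:R - 2^-1) = 0) ?normr0 ?ler0_norm; lra.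
- rewrite subrr normr0 ler0_norm; lra.
Qed.

Lemma norm_same_sign (n : nat) (t e : 'I_n -> R) : (forall l, 0 <= t l) ->
  (forall l, 0 <= e l) \/ (forall l, e l <= 0) ->
  `|\sum_l t l * e l| = \sum_l t l * `|e l|.
Proof.
move=> t0 [e0|e0].
  rewrite ger0_norm; last by apply: sumr_ge0 => l _; rewrite mulr_ge0.
  by apply: eq_bigr => l _; rewrite ger0_norm.
rewrite ler0_norm; last by apply: sumr_le0 => l _; rewrite mulr_ge0_le0.
by rewrite -sumrN; apply: eq_bigr => l _; rewrite ler0_norm// mulrN.
Qed.

(* No simplex of the block meets both sides of the planes
   [block_coord 0 X = +/- block_coord c X]. *)
Lemma simplex_same_sign (sg : bool) a i j (c : 'I_3) : c != 0 ->
  face a i j -> enorm (z R i - z R j) = 1 ->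
  let e l := block_coord 0 (tnth (simplex a i j) l)
    + (-1) ^+ sg * block_coord c (tnth (simplex a i j) l) in
  (forall l, 0 <= e l) \/ (forall l, e l <= 0).
Proof.
move=> c0; rewrite faceE => /eqP fij zij e.
have ham : hamming i j = 1%N.
  move: zij; rewrite enorm_z -[RHS]sqrtr1 => /eqP.
  by rewrite eqr_sqrt ?ler0n//; rewrite (eqr_nat R _ 1) => /eqP.
have eE l : e l = nth 0 [:: 0;
    (if 0 == a then (cbit a i)%:R - 2^-1 else 0)
      + (-1) ^+ sg * (if c == a then (cbit a i)%:R - 2^-1 else 0);
    ((cbit 0 i)%:R - 2^-1) + (-1) ^+ sg * ((cbit c i)%:R - 2^-1);
    ((cbit 0 j)%:R - 2^-1) + (-1) ^+ sg * ((cbit c j)%:R - 2^-1)] l.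
  rewrite /e; case: l => [[|[|[|[|//]]]] il]; rewrite (tnth_nth 0)/=.
  - by rewrite !block_coord_centre mulr0 addr0.
  - by rewrite !block_coord_face.
  - by rewrite !pt_corner_coord.
  - by rewrite !pt_corner_coord.
suff [[h1 h2 h3]|[h1 h2 h3]] :
    [/\ 0 <= e 1, 0 <= e (inord 2) & 0 <= e (inord 3)]
    \/ [/\ e 1 <= 0, e (inord 2) <= 0 & e (inord 3) <= 0].
- left; case=> [[|[|[|[|//]]]] il].
  + by rewrite eE.
  + by move: h1; rewrite !eE.
  + by move: h2; rewrite !eE/= inordK.
  + by move: h3; rewrite !eE/= inordK.
- right; case=> [[|[|[|[|//]]]] il].
  + by rewrite eE.
  + by move: h1; rewrite !eE.
  + by move: h2; rewrite !eE/= inordK.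
  + by move: h3; rewrite !eE/= inordK.
rewrite !eE/= !inordK//= {e eE zij}; move: ham fij c0; rewrite /hamming.
case: c => [[|[|[|//]]] ?] //; case: a => [[|[|[|//]]] ?] /=; rewrite -?val_eqE/=.
all: case: (cbit 0 i); case: (cbit 0 j); case: (cbit 1 i); case: (cbit 1 j);
  case: (cbit 2 i); case: (cbit 2 j) => //= _ _ _; case: sg => /=;
  rewrite ?expr0 ?expr1; solve [left; split; lra|right; split; lra].
Qed.

(** At the block centre and the face centres at most one coordinate is nonzero, so [cross] vanishes
    there, as do the corresponding averages of the corner products. On a simplex
    [block_coord 0 + block_coord c] and [block_coord 0 - block_coord c] keep their signs, so both
    absolute values in [cross] are affine. *)
Lemma block_interp_cross c : c != 0 ->
  block_interp (fun X => cross (block_coord 0 X) (block_coord c X)).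
Proof.
move=> c0; split.
- rewrite !block_coord_centre cross0l.
  under eq_bigr do rewrite !pt_corner_coord cross_corner.
  rewrite !big_ord_recl !big_ord0.
  by case: c c0 => [[|[|[|//]]] ?] //= _; rewrite /bump/=; field.
- move=> a i; rewrite !block_coord_face.
  under eq_bigr do rewrite !pt_corner_coord cross_corner.
  have -> : \sum_(j | face a i j) ((cbit 0 j)%:R - 2^-1) * ((cbit c j)%:R - 2^-1 : R)
      = \sum_(j | face a i j) ((cbit 0 j)%:R - 2^-1) *
      ((nth 0%N [:: cbit 0 j : nat; cbit 1 j : nat; cbit 2 j : nat] c)%:R - 2^-1).
    by apply: eq_bigr => j _; case: c {c0} => [[|[|[|//]]] ?].
  rewrite (sum_face (fun b0 b1 b2 =>
    (b0%:R - 2^-1) * ((nth 0%N [:: b0; b1; b2] c)%:R - 2^-1))).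
  rewrite !big_ord_recl !big_ord0.
  by case: c c0 => [[|[|[|//]]] ?] // _; case: a => [[|[|[|//]]] ?] /=;
    rewrite -?val_eqE/= ?cross0l ?cross0r; case: (cbit _ i) => //=; rewrite /bump/=; field.
- move=> a i j fij zij t t0 t1; rewrite !block_coord_sum// /cross.
  have sP := @simplex_same_sign false a i j c c0 fij zij.
  have sN := @simplex_same_sign true a i j c c0 fij zij.
  set q := tnth (simplex a i j) in sP sN *.
  have e (sg : bool) : \sum_l t l * block_coord 0 (q l)
      + (-1) ^+ sg * \sum_l t l * block_coord c (q l)
      = \sum_l t l * (block_coord 0 (q l) + (-1) ^+ sg * block_coord c (q l)).
    rewrite mulr_sumr -big_split; apply: eq_bigr => l _.
    by rewrite /=; set u := (-1) ^+ sg; ring.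
  have := e false; have := e true; rewrite /= expr0 expr1 mul1r mulN1r => -> ->.
  have := norm_same_sign t0 sP; have := norm_same_sign t0 sN.
  rewrite /= expr0 expr1 => -> ->; rewrite -sumrB mulr_suml; apply: eq_bigr => l _.
  by rewrite mul1r mulN1r; ring.
Qed.

End BlockInterpolation.

(** * A rod broken between two layers *)

Section Interpolant.
Variable R : realType.

(* Interpolates [t * x] on the layer [0 <= t <= 1] divided into the unit squares
   with integer corners. *)
Definition tx_interp (t x : R) : R :=
  x / 2 + (t - 2^-1) * ((Num.floor x)%:~R + 2^-1)
  + cross (t - 2^-1) (x - (Num.floor x)%:~R - 2^-1).

Lemma cross_halfl (b : R) : `|b| <= 2^-1 ->
  (cross 2^-1 b = b / 2) * (cross (- 2^-1) b = - b / 2).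
Proof.
rewrite ler_norml => /andP[b1 b2]; rewrite /cross.
by split; [rewrite !ger0_norm|rewrite !ler0_norm]; lra.
Qed.

Lemma cross_halfr (a : R) : `|a| <= 2^-1 ->
  (cross a 2^-1 = a / 2) * (cross a (- 2^-1) = - a / 2).
Proof.
rewrite ler_norml => /andP[a1 a2]; rewrite /cross; split.
- by rewrite ger0_norm ?ler0_norm; lra.
- by rewrite ler0_norm ?ger0_norm; lra.
Qed.

Lemma floor_offset (x : R) : `|x - (Num.floor x)%:~R - 2^-1| <= 2^-1.
Proof.
have := floor_itv x; rewrite intrD => /andP[f1 f2].
by rewrite ler_norml; apply/andP; split; lra.
Qed.

Lemma tx_interp01 (x : R) : (tx_interp 0 x = 0) * (tx_interp 1 x = x).
Proof.
have [e1 e0] := cross_halfl (floor_offset x).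
by rewrite /tx_interp sub0r (_ : 1 - 2^-1 = 2^-1) ?e0 ?e1; [split|]; lra.
Qed.

(** The formula comes from [t x = x / 2 + (t - 1/2) c + (t - 1/2) (x - c)], where [cross] replaces
    the last product, with which it agrees at the corners of the square centred at [(1/2, c)]. *)
Lemma tx_interp_square (t x c : R) (m : int) : c = m%:~R + 2^-1 ->
  `|t - 2^-1| <= 2^-1 -> `|x - c| <= 2^-1 ->
  tx_interp t x = x / 2 + (t - 2^-1) * c + cross (t - 2^-1) (x - c).
Proof.
move=> -> ht hx; rewrite /tx_interp.
have [lt|ge] := ltP x (m%:~R + 1).
  have -> : Num.floor x = m.
    apply: floor_def; rewrite intrD lt andbT.
    by move: hx; rewrite ler_norml; lra.
  by rewrite opprD addrA.
(* On the right edge the floor selects the next square; [cross] is linear on edges, and the two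
   formulas agree. *)
have xE : x = (m + 1)%:~R.
  apply/eqP; rewrite eq_le intrD ge andbT.
  by move: hx; rewrite ler_norml; lra.
rewrite xE intrKfloor intrD.
have -> : m%:~R + 1 - (m%:~R + 1) - 2^-1 = - 2^-1 :> R by ring.
have -> : m%:~R + 1 - (m%:~R + 2^-1) = 2^-1 :> R by field.
by rewrite !(cross_halfr ht); field.
Qed.

Variables (r : R) (k : nat) (Qp Qm : 'M[R]_3) (cp cm : 'cV[R]_3).
Hypotheses (r0 : 0 < r) (k0 : (0 < k)%N).

Let h := mesh r k.
Let A (Q : 'M[R]_3) (c : 'cV[R]_3) b (X : 'cV[R]_3) : R :=
  Q b 0 * (r * X 0 0) + Q b 1 * (k%:R^-1 * X 1 0)
  + Q b (inord 2) * (k%:R^-1 * X (inord 2) 0) + c b 0.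

(** In the broken layer, with [t = X 0 0 / h], the atoms at [t = 0] follow the motion [(Qm, cm)] and
    those at [t = 1] the motion [(Qp, cp)]. Adding [t] times the difference of the two motions to
    the first would produce the bilinear terms [t x], for which [tx_interp] is substituted. *)
Definition transition (X : 'cV[R]_3) : 'cV[R]_3 := \col_b
  (if X 0 0 <= 0 then A Qm cm b X else if h <= X 0 0 then A Qp cp b X
   else A Qm cm b X
     + X 0 0 / h * ((cp - cm) b 0 + (Qp - Qm) b 0 * (r * h))
     + tx_interp (X 0 0 / h) (X 1 0) * ((Qp - Qm) b 1 / k%:R)
     + tx_interp (X 0 0 / h) (X (inord 2) 0) * ((Qp - Qm) b (inord 2) / k%:R)).

Lemma rigid_coord Q c b w x :
  (Q *m pt (r * w) (k%:R^-1 *: x) + c) b 0 = A Q c b (pt w x).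
Proof.
rewrite linmxE mxE sum_ord3 /A !ptE0.
by rewrite !(@ptES _ _ _ 1 0)// !(@ptES _ _ _ (inord 2) 1) ?inordK// !linmxE.
Qed.

Lemma transition_low w x : w <= 0 ->
  transition (pt w x) = Qm *m pt (r * w) (k%:R^-1 *: x) + cm.
Proof.
move=> w0; apply/matrixP => b j; rewrite (ord1 j) rigid_coord mxE.
by rewrite {1}ptE0 w0.
Qed.

Lemma transition_high w x : h <= w ->
  transition (pt w x) = Qp *m pt (r * w) (k%:R^-1 *: x) + cp.
Proof.
move=> hw; apply/matrixP => b j; rewrite (ord1 j) rigid_coord mxE.
by rewrite {1}ptE0 leNgt (lt_le_trans (mesh_gt0 r0 k0) hw)/= {1}ptE0 hw.
Qed.

Lemma rigid_block_interp Q c b w x' : block_interp h w x' (A Q c b).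
Proof.
have h0 : 0 < h := mesh_gt0 r0 k0.
apply: (@eq_block_interp _ _ _ _ h0 _ (fun X =>
   Q b 0 * r * h * block_coord h w x' 0 X + (Q b 1 / k%:R * block_coord h w x' 1 X
   + (Q b (inord 2) / k%:R * block_coord h w x' (inord 2) X
   + (Q b 0 * r * w + Q b 1 / k%:R * x' 0 0 + Q b (inord 2) / k%:R * x' 1 0 + c b 0)))%R)).
  move=> X _; rewrite /block_coord /A eqxx -!val_eqE /= inordK//=.
  rewrite (@ptES _ _ _ 1 0)// (@ptES _ _ _ (inord 2) 1) ?inordK//.
  have hn : h != 0 by rewrite gt_eqF.
  have kn : k%:R != 0 :> R by rewrite pnatr_eq0 -lt0n.
  by field; rewrite hn kn.
do 3!(apply: block_interpD; first by apply: block_interpZ; exact: block_interp_coord).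
exact: block_interp_cst.
Qed.

Lemma block_PAff (v : 'cV[R]_3 -> 'cV[R]_3) S L' :
  (forall w x', lext L' x' ->
     (forall i, Lambda S r k (corner h w x' i)) ->
     forall b, block_interp h w x' (fun X => v X b 0)) ->
  PAff S L' r k v.
Proof.
move=> vI w x' q p face fc Lx Lam; split.
- apply/matrixP => b j; rewrite (ord1 j) linmxE summxE.
  by have [-> _ _] := vI w x' Lx Lam b.
- move=> a i; apply/matrixP => b j; rewrite (ord1 j) linmxE summxE.
  by have [_ -> _] := vI w x' Lx Lam b.
- move=> a i j fij zij t t0 t1; apply/matrixP => b l; rewrite (ord1 l) summxE.
  have [_ _ s3] := vI w x' Lx Lam b.
  by rewrite s3//; apply: eq_bigr => m _; rewrite linmxE.
Qed.

(** The corners lie on layers of atoms, so no block straddles the planes [X 0 0 = 0] and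
    [X 0 0 = h]: the map is rigid on blocks with [m < 0] or [m > 0], and only [m = 0] needs the
    interpolant. *)
Lemma transition_PAff S L' : cross_section S L' -> PAff S L' r k transition.
Proof.
move=> hS; have h0 : 0 < h := mesh_gt0 r0 k0.
apply: block_PAff => w x' Lx Lam b.
have [m wm] : exists m : int, w = (m%:~R + 2^-1) * h.
  have [[m em] _ _] := Lam ord0; exists m.
  by move: em; rewrite /corner/= z1E -/h mulrDl => <-; rewrite /=; ring.
have hi : 0 < h^-1 by rewrite (invr_gt0 h).
have bw X : in_block h w x' X -> m%:~R * h <= X 0 0 <= (m%:~R + 1) * h.
  move=> /(_ 0); rewrite /block_coord eqxx normrM (gtr0_norm hi).
  rewrite ler_pdivrMr// wm ler_norml => /andP[b1 b2].
  by apply/andP; split; lra.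
have [mN|m0] := ltP m 0.
  apply: (@eq_block_interp _ _ _ _ h0 _ (A Qm cm b)); last exact: rigid_block_interp.
  move=> X /bw/andP[_ Xh]; rewrite mxE ifT//.
  have mNR : (m + 1)%:~R <= 0 :> R by rewrite lerz0; lia.
  by apply: (le_trans Xh); rewrite pmulr_lle0// -(intrD _ m 1).
move: m0; rewrite le_eqVlt => /predU1P[m0|m1]; last first.
  apply: (@eq_block_interp _ _ _ _ h0 _ (A Qp cp b)); last exact: rigid_block_interp.
  move=> X /bw/andP[Xh _].
  have hX : h <= X 0 0.
    have m1R : 1%:~R <= m%:~R :> R by rewrite ler_int.
    by apply: le_trans Xh; apply: ler_peMl m1R; exact: ltW.
  by rewrite mxE leNgt (lt_le_trans h0 hX)/= hX.
(* Centres in [lext L'] are half-integer, so the squares used by [tx_interp] are the cross-sections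
   of the blocks. *)
have [x0 Lx0 [d ds dx]] := Lx.
have half (a : 'I_2) : exists n : int, x' a 0 = n%:~R + 2^-1.
  have [n en] := centre_half_integer hS a Lx0.
  have : d a 0 \is a Num.int.
    by have := ds a; rewrite !inE => /or3P[] /eqP ->; rewrite ?rpredN ?rpred1 ?rpred0.
  move=> /intrP[n' en']; exists (n + n').
  by rewrite -dx linmxE en en' intrD; ring.
have [[n1 e1] [n2 e2]] := (half 0, half 1).
have wh : w = h / 2 by rewrite wm -m0; ring.
have c1E X : block_coord h w x' 1 X = X 1 0 - x' 0 0.
  by rewrite /block_coord -val_eqE/= (@ptES _ _ _ 1 0).
have c2E X : block_coord h w x' (inord 2) X = X (inord 2) 0 - x' 1 0.
  by rewrite /block_coord -val_eqE/= inordK//= (@ptES _ _ _ (inord 2) 1) ?inordK.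
have c0E X : block_coord h w x' 0 X = X 0 0 / h - 2^-1.
  by rewrite /block_coord eqxx wh; field; rewrite gt_eqF.
pose T (c : 'I_3) (y u : R) (X : 'cV[R]_3) : R :=
  (block_coord h w x' c X + y) / 2 * u + block_coord h w x' 0 X * y * u
  + cross (block_coord h w x' 0 X) (block_coord h w x' c X) * u.
pose g X := A Qm cm b X
     + (block_coord h w x' 0 X + 2^-1) * ((cp - cm) b 0 + (Qp - Qm) b 0 * (r * h))
     + T 1 (x' 0 0) ((Qp - Qm) b 1 / k%:R) X
     + T (inord 2) (x' 1 0) ((Qp - Qm) b (inord 2) / k%:R) X.
have gI : block_interp h w x' g.
  have TI c y u : c != 0 -> block_interp h w x' (T c y u).
    move=> c0; apply: (@eq_block_interp _ _ _ _ h0 _ (fun X =>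
      (u / 2 * block_coord h w x' c X + y / 2 * u) + (y * u * block_coord h w x' 0 X
      + u * cross (block_coord h w x' 0 X) (block_coord h w x' c X)))).
      by move=> X _; rewrite /T; ring.
    apply: block_interpD; apply: block_interpD.
    - by apply: block_interpZ; exact: block_interp_coord.
    - exact: block_interp_cst.
    - by apply: block_interpZ; exact: block_interp_coord.
    - by apply: block_interpZ; exact: block_interp_cross.
  apply: block_interpD; last by apply: TI; rewrite -val_eqE/= inordK.
  apply: block_interpD; last by apply: TI; rewrite -val_eqE.
  apply: block_interpD; first exact: rigid_block_interp.
  set u := _ + _ * _.
  apply: (@eq_block_interp _ _ _ _ h0 _ (fun X => u * block_coord h w x' 0 X + u / 2)).
    by move=> X _; ring.
  apply: block_interpD; last exact: block_interp_cst.
  by apply: block_interpZ; exact: block_interp_coord.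
apply: eq_block_interp gI => // X Xb.
have /andP[X0 Xh] := bw X Xb.
rewrite -m0 mul0r in X0; rewrite -m0 add0r mul1r in Xh.
have T1 : T 1 (x' 0 0) ((Qp - Qm) b 1 / k%:R) X
    = tx_interp (X 0 0 / h) (X 1 0) * ((Qp - Qm) b 1 / k%:R).
  have := Xb 0; have := Xb 1; rewrite c1E c0E => b1 b0.
  by rewrite (tx_interp_square e1 b0 b1) /T c1E c0E; ring.
have T2 : T (inord 2) (x' 1 0) ((Qp - Qm) b (inord 2) / k%:R) X
    = tx_interp (X 0 0 / h) (X (inord 2) 0) * ((Qp - Qm) b (inord 2) / k%:R).
  have := Xb 0; have := Xb (inord 2); rewrite c2E c0E => b1 b0.
  by rewrite (tx_interp_square e2 b0 b1) /T c2E c0E; ring.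
rewrite /g T1 T2 c0E subrK mxE.
have hn : h != 0 by rewrite gt_eqF.
have kn : k%:R != 0 :> R by rewrite pnatr_eq0 -lt0n.
(* On the two bounding planes the definition uses the rigid motions, with which the interpolant
   agrees. *)
case: ifPn => [Xle|_].
  have -> : X 0 0 = 0 by apply/eqP; rewrite eq_le Xle X0.
  by rewrite mul0r !tx_interp01 !mul0r !addr0.
case: ifPn => // hX.
have -> : X 0 0 = h by apply/eqP; rewrite eq_le hX Xh.
rewrite mulfV// !tx_interp01 /A !linmxE.
have -> : X 0 0 = h by apply/eqP; rewrite eq_le hX Xh.
by field; rewrite kn.
Qed.

End Interpolant.

(** * Recovery sequence *)

Lemma scale_pt (R : realType) (c s : R) (x : 'cV[R]_2) :
  c *: pt s x = pt (c * s) (c *: x).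
Proof.
apply/matrixP => a b; rewrite /pt !mxE; case: splitP => j _; rewrite !mxE//.
by rewrite mulrnAr.
Qed.

Lemma pt_corner (R : realType) (m : R) (x : 'cV[R]_2) (i : 'I_8) :
  pt (m + (cbit 0 i)%:R) (x + z' R i) = pt (m + 2^-1) x + z R i.
Proof.
apply/matrixP => a b; rewrite (ord1 b) linmxE zE.
have [->|[c ac]] : a = 0 \/ exists c : 'I_2, a = c.+1 :> nat.
  case: a => [[|[|[|//]]] ia]; [by left; exact: val_inj|by right; exists 0|by right; exists 1].
- by rewrite !ptE0; ring.
- by rewrite !(ptES _ _ ac) linmxE z'E -ac; ring.
Qed.

Lemma enorm_rotation (R : realType) (Q : 'M[R]_3) (x : 'cV[R]_3) :
  O3 Q -> enorm (Q *m x) = enorm x.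
Proof.
have enormE (y : 'cV[R]_3) : enorm y = Num.sqrt ((y^T *m y) 0 0).
  rewrite /enorm mxE; congr Num.sqrt; apply: eq_bigr => i _.
  by rewrite big_ord1 mxE expr2.
by move=> QQ; rewrite !enormE trmx_mul mulmxA -(mulmxA x^T) QQ mulmx1.
Qed.

Lemma limn_esup_eq (R : realType) (u : nat -> \bar R) (c : R) :
  (forall e : R, 0 < e ->
    \forall n \near \oo, ((c - e)%:E <= u n <= (c + e)%:E)%E) ->
  limn_esup u = c%:E.
Proof.
move=> uc; have ulim : u n @[n \oo] --> c%:E.
  apply/fine_cvgP; split.
    apply: filterS (uc 1 ltr01) => n /andP[u1 u2].
    by rewrite fin_numE; case: (u n) u1 u2.
  apply/cvgrPdist_le => e e0; apply: filterS (uc e e0) => n /=.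
  rewrite ler_distlC => /andP[]; case: (u n) => [x| |] /=.
  - by rewrite !lee_fin => -> ->.
  - by rewrite leye_eq.
  - by rewrite leeNy_eq.
have cu : cvgn u by apply/cvg_ex; exists c%:E.
by rewrite (is_cvg_limn_esupE cu); exact: cvg_lim.
Qed.

Section Recovery.
Variables (R : realType) (L : R) (S L' : set 'cV[R]_2) (cf : nat -> R).
Variables (WNN WNNN WbarNN WbarNNN : nat -> R -> \bar R) (W0NN W0NNN : R -> R).
Variable chi : nat -> 'M[R]_(3, 8) -> R.
Variables (cfrac : nat -> R) (W0 : 'cV[R]_2 -> 'M[R]_(3, 8) -> \bar R).
Variables omegaNN omegaNNN : R.
Hypothesis hS : cross_section S L'.
Hypothesis hcf : threshold cf.
Hypothesis hNN : pair_potential cf WNN WbarNN W0NN.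
Hypothesis hNNN : pair_potential cf WNNN WbarNNN W0NNN.
Hypothesis hchi : orientation_penalty chi.
Hypothesis hW : standing_assumptions L S L' (Wcell WNN WNNN chi)
  (Wsurf S WNN WNNN) (Wend L S WNN WNNN) cfrac W0.
Hypothesis hfarNN : far_limit WbarNN omegaNN.
Hypothesis hfarNNN : far_limit WbarNNN omegaNNN.
Variables (yp ym : 'cV[R]_3) (Rp Rm : 'M[R]_3).
Hypotheses (SORp : SO3 Rp) (SORm : SO3 Rm) (ypm : yp != ym).

Local Notation W := (Wtot L' (Wcell WNN WNNN chi) (Wsurf S WNN WNNN)).
Local Notation nb h := (#|` fset_set (bond_pairs S h)|%:R : R).

(** With [k = (n + 2)^2] the product [r k = n + 2] diverges and the mesh is [1 / (n + 2) <= 1/2], so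
    the broken layer ends before the rigid part at 3/4. *)
Definition rec_rate (n : nat) : R := n.+2%:R^-1.
Definition rec_index (n : nat) : nat := (n.+2 ^ 2)%N.
Definition rec_map (n : nat) : 'cV[R]_3 -> 'cV[R]_3 :=
  transition (rec_rate n) (rec_index n) Rp Rm yp ym.

Lemma rec_rate_gt0 n : 0 < rec_rate n.
Proof. by rewrite invr_gt0. Qed.

Lemma rec_index_gt0 n : (0 < rec_index n)%N.
Proof. by rewrite expn_gt0. Qed.

Lemma rec_rate_index n : rec_rate n * (rec_index n)%:R = n.+2%:R.
Proof. by rewrite /rec_rate /rec_index natrX expr2 mulKf// pnatr_eq0. Qed.

Lemma rec_mesh n : mesh (rec_rate n) (rec_index n) = n.+2%:R^-1.
Proof. by rewrite /mesh rec_rate_index. Qed.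

Lemma rec_transition_sequences :
  transition_sequences S L' yp ym Rp Rm rec_rate rec_index rec_map.
Proof.
split.
- move=> n; split; [exact: rec_rate_gt0|exact: rec_index_gt0|].
  exact: (transition_PAff _ _ _ _ (rec_rate_gt0 n) (rec_index_gt0 n) hS).
- split.
    by move=> m n mn; rewrite lef_pV2 ?posrE// ler_nat.
  have := @cvg_harmonic R; rewrite -(cvg_shiftS (@harmonic R)); exact.
- apply/cvgryPge => A; near=> n; rewrite rec_rate_index.
  have nA : A <= n%:R by near: n; exact: nbhs_infty_ger.
  by rewrite (le_trans nA)// ler_nat -addn2 leq_addr.
- exists (fun=> Rp), (fun=> Rm), (fun=> yp), (fun=> ym); split => //.
  + by split; exact: cvg_cst.
  + by split; exact: cvg_cst.
  + move=> n; split => w x'; rewrite /= in_itv/= => /andP[w1 w2] _.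
      apply: (transition_high _ _ _ _ (rec_rate_gt0 n) (rec_index_gt0 n)).
      rewrite rec_mesh (le_trans _ w1)// (le_trans (_ : _ <= 2^-1))//; last by lra.
      by rewrite lef_pV2 ?posrE// ler_nat.
    by apply: transition_low; lra.
Unshelve. all: by end_near.
Qed.

Lemma rec_atom n m p : atom (rec_rate n) (rec_index n) (rec_map n) m p =
  (if 0 < m then Rp else Rm) *m pt m%:~R p
  + (rec_index n)%:R *: (if 0 < m then yp else ym).
Proof.
have h0 := mesh_gt0 (rec_rate_gt0 n) (rec_index_gt0 n).
have k0 : (rec_index n)%:R != 0 :> R by rewrite pnatr_eq0 -lt0n rec_index_gt0.
have sc : (rec_index n)%:R * (rec_rate n * (m%:~R * mesh (rec_rate n) (rec_index n)))
    = m%:~R :> R.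
  rewrite mulrA [_ * rec_rate n]mulrC rec_rate_index rec_mesh mulrCA.
  by rewrite mulfV ?pnatr_eq0// mulr1.
have E (Q : 'M[R]_3) c : (rec_index n)%:R *: (Q *m
    pt (rec_rate n * (m%:~R * mesh (rec_rate n) (rec_index n))) ((rec_index n)%:R^-1 *: p)
    + c) = Q *m pt m%:~R p + (rec_index n)%:R *: c.
  by rewrite scalerDr scalemxAr scale_pt sc scalerA mulfV// scale1r.
rewrite /atom /rec_map; case: ifPn => m0.
  rewrite transition_high ?E ?rec_rate_gt0 ?rec_index_gt0//.
  have m1R : 1%:~R <= m%:~R :> R by rewrite ler_int.
  by apply: ler_peMl m1R; exact: ltW.
rewrite transition_low ?E//.
have m0R : m%:~R <= 0 :> R by rewrite lerz0 leNgt.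
by rewrite pmulr_lle0.
Qed.

(** Both atomic layers of such a cell lie on the same side of the gap, so the cell is a rigid image
    of [Idbar], where [sa_min] gives zero energy. *)
Lemma rec_layer_zero n (m : int) x' : m != 0 -> lext L' x' ->
  W (rec_index n) x' (cell_at (rec_rate n) (rec_index n) (rec_map n) m x') = 0%E.
Proof.
move=> m0 Lx; set Q := if 0 < m then Rp else Rm; set c := if 0 < m then yp else ym.
have SOQ : SO3 Q by rewrite /Q; case: ifP.
have -> : cell_at (rec_rate n) (rec_index n) (rec_map n) m x' = rigid_image Q
    (Q *m pt (m%:~R + 2^-1) x' + (rec_index n)%:R *: c) (Idbar R).
  apply/matrixP => a i.
  have -> : cell_at (rec_rate n) (rec_index n) (rec_map n) m x' a i =
      col i (cell_at (rec_rate n) (rec_index n) (rec_map n) m x') a 0 by rewrite [RHS]mxE.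
  rewrite col_cell_at rec_atom.
  (* Only [m = 0] separates the signs of [m] and [m + 1]. *)
  have -> : (0 < (if cbit 0 i then m + 1 else m)) = (0 < m).
    by case: cbit => //; apply/idP/idP; lia.
  rewrite -/Q -/c.
  have -> : (if cbit 0 i then m + 1 else m)%:~R = m%:~R + (cbit 0 i)%:R :> R.
    by case: cbit; rewrite ?intrD ?addr0.
  have zQ : (Q *m z R i) a 0 = (Q *m Idbar R) a i.
    by rewrite mxE [RHS]mxE; apply: eq_bigr => b _; rewrite /z [X in _ * X]mxE.
  rewrite pt_corner mulmxDr /rigid_image !addmxE zQ [X in _ = _ + X]mxE !addmxE.
  by rewrite [RHS]addrC -!addrA; congr (_ + _); exact: addrC.
rewrite /Wtot; case: ifPn => [_|/negP xL].
  by apply: (sa_min hW (rec_index_gt0 n)) => //; constructor 1.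
apply: (sa_min hW (rec_index_gt0 n)) => //; constructor 2; exists x' => //.
by split => // Lx'; apply: xL; exact/mem_set.
Qed.

(** Within one atomic layer a single rigid motion acts, so these bonds keep their length and sit at
    the zero of the potentials. *)
Lemma rec_horizontal n x' : let y := cell_at (rec_rate n) (rec_index n) (rec_map n) 0 x' in
  chi (rec_index n) y = 0 -> horizontal_energy S L' WNN WNNN chi (rec_index n) x' y = 0%E.
Proof.
move=> y chi0; have k0 := rec_index_gt0 n.
have cancel (a b c : 'cV[R]_3) : a + c - (b + c) = a - b.
  by rewrite opprD addrACA subrr addr0.
have cancel' (a b c : 'cV[R]_3) : c + a - (c + b) = a - b.
  by rewrite opprD addrACA subrr add0r.
have len h A e : bonds A (Num.sqrt (h%:R : R)) e && horizontal e ->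
    bond_length y e = Num.sqrt h%:R.
  rewrite /bonds => /andP[/and3P[_ _ /eqP <-] /eqP hor].
  rewrite /bond_length !col_cell_at !rec_atom hor cancel -mulmxBr.
  set Q := if _ then Rp else Rm.
  have OQ : O3 Q by rewrite /Q; case: ifP => _; [case: SORp|case: SORm].
  have -> : (if cbit 0 e.2 then 0 + 1 else 0 : int)%:~R
      = 0 + (cbit 0 e.2)%:R :> R by case: cbit; rewrite ?add0r.
  by rewrite -{1}hor !pt_corner cancel' enorm_rotation.
rewrite /horizontal_energy chi0 if_same !big1 ?mule0 ?adde0//.
- move=> e /len ->; rewrite divff ?gt_eqF ?sqrtr_gt0//.
  exact/(pp_eq0 hNNN k0 ler01).
- move=> e /len ->; rewrite sqrtr1.
  exact/(pp_eq0 hNN k0 ler01).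
Qed.

Lemma rec_jump (A B : R) : exists a, \forall n \near \oo, forall p q : 'cV[R]_2,
  (forall b, `|p b 0| <= B) -> (forall b, `|q b 0| <= B) ->
  A <= `|(atom (rec_rate n) (rec_index n) (rec_map n) 0 p
         - atom (rec_rate n) (rec_index n) (rec_map n) 1 q) a 0|.
Proof.
have [a ya] : exists a, (ym - yp) a 0 != 0.
  apply: contrapT => no; move: ypm; rewrite eq_sym -subr_eq0 => /eqP; apply.
  apply/matrixP => a b; rewrite (ord1 b) [RHS]mxE.
  by apply: contrapT => /eqP ne; apply: no; exists a.
exists a; have d0 : 0 < `|(ym - yp) a 0| by rewrite normr_gt0.
near=> n; move=> p q pB qB; rewrite !rec_atom ltxx ltr01.
have bp := rotation_entry_bound 0%:~R p a SORm.
have bq := rotation_entry_bound 1%:~R q a SORp.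
(* The gap contributes [k |(ym - yp) a|]; the two rotated points, at axial positions 0 and 1, take
   away at most [4 B + 1]. *)
have kA : (A + 4 * B + 1) / `|(ym - yp) a 0| <= (rec_index n)%:R.
  have nA : (A + 4 * B + 1) / `|(ym - yp) a 0| <= n%:R.
    by near: n; exact: nbhs_infty_ger.
  rewrite (le_trans nA)// ler_nat /rec_index expnS expn1; nia.
rewrite ler_pdivrMr// in kA.
set P := Rm *m _ in bp *; set P' := Rp *m _ in bq *.
have -> : (P + (rec_index n)%:R *: ym - (P' + (rec_index n)%:R *: yp)) a 0 =
    (rec_index n)%:R * (ym - yp) a 0 - (P' a 0 - P a 0) by rewrite !linmxE; ring.
have := lerB_dist ((rec_index n)%:R * (ym - yp) a 0) (P' a 0 - P a 0).
have := ler_normB (P' a 0) (P a 0).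
rewrite normrM ger0_norm// => h1 h2; apply: le_trans h2.
have := pB 0; have := pB 1; have := qB 0; have := qB 1.
move: bp bq; rewrite normr0 normr1; lra.
Unshelve. all: by end_near.
Qed.

Lemma rec_energy n :
  (forall x', lext L' x' ->
    chi (rec_index n) (cell_at (rec_rate n) (rec_index n) (rec_map n) 0 x') = 0) ->
  scaled_energy L' W (rec_rate n) (rec_index n) (rec_map n) =
  (\sum_(p \in bond_pairs S 1) ((rec_index n)%:R%:E *
     WNN (rec_index n) (bond (rec_rate n) (rec_index n) (rec_map n) 0 p))
   + \sum_(p \in bond_pairs S 2) ((rec_index n)%:R%:E *
     WNNN (rec_index n)
       (bond (rec_rate n) (rec_index n) (rec_map n) 0 p / Num.sqrt 2)%R))%E.
Proof.
move=> chi0; have r0 := rec_rate_gt0 n; have k0 := rec_index_gt0 n.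
have h0 := mesh_gt0 r0 k0.
have WNN0 p : (0 <= WNN (rec_index n)
    (bond (rec_rate n) (rec_index n) (rec_map n) 0 p))%E.
  by apply: (WNN_ge0 hNN) => //; exact: enorm_ge0.
have WNNN0 p : (0 <= WNNN (rec_index n)
    (bond (rec_rate n) (rec_index n) (rec_map n) 0 p / Num.sqrt 2)%R)%E.
  by apply: (WNNN_ge0 hNNN) => //; exact: enorm_ge0.
rewrite (scaled_energy_layers hS hNN hNNN hchi)//.
set F := fun m => (_ * _)%E.
have -> : (\sum_(m \in layers (mesh (rec_rate n) (rec_index n))) F m = F (0 : int))%E.
  rewrite (fsbigD1 (0 : int)); [|exact: finite_layers|]; last first.
    by rewrite /layers/= mul0r addr0; apply/andP; split; lra.
  rewrite fsbig1; first exact: adde0.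
  move=> m [_ m0].
  by rewrite /F fsbig1 ?mule0// => x' Lx; apply: rec_layer_zero => //; exact/eqP.
rewrite /F (layer_energy chi hS hNN hNNN k0 (U := fun b =>
  atom (rec_rate n) (rec_index n) (rec_map n) (if b then 0 + 1 else 0))); last first.
  by move=> x' i; exact: col_cell_at.
have -> : (\sum_(x' \in lext L') horizontal_energy S L' WNN WNNN chi (rec_index n) x'
    (cell_at (rec_rate n) (rec_index n) (rec_map n) 0 x') = 0)%E.
  by apply: fsbig1 => x' Lx; apply: rec_horizontal; exact: chi0.
rewrite adde0.
rewrite ge0_muleDr.
- by congr (_ + _)%E; apply: ge0_mule_fsumr => p; [exact: WNN0|exact: WNNN0].
- by apply: fsume_ge0 => p _; exact: WNN0.
- by apply: fsume_ge0 => p _; exact: WNNN0.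
Qed.

(** Entries of the discrete gradient at two corners differ exactly as the atomic positions do.
    Across the gap this difference diverges, so the gradient leaves the bounded set on which [chi]
    is supported. *)
Lemma rec_chi_near : \forall n \near \oo, forall x', lext L' x' ->
  chi (rec_index n) (cell_at (rec_rate n) (rec_index n) (rec_map n) 0 x') = 0.
Proof.
have [N [cbar [_ [M [_ NM]] _ chiN]]] := op_support hchi.
have [B B0 LB] := finite_entry_bound (finite_lext hS).
(* On that set two gradient entries differ by at most [2 (M + 1)]; [B + 1] bounds the coordinates of
   the corners of the cells. *)
have [a jump] := rec_jump (2 * (M + 1) + 1) (B + 1).
near=> n; move=> x' Lx.
have jn : forall p q : 'cV[R]_2, (forall b, `|p b 0| <= B + 1) ->
    (forall b, `|q b 0| <= B + 1) -> 2 * (M + 1) + 1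
    <= `|(atom (rec_rate n) (rec_index n) (rec_map n) 0 p
       - atom (rec_rate n) (rec_index n) (rec_map n) 1 q) a 0| by near: n.
set y := cell_at _ _ _ 0 x'.
have [_ ->//] := chiN _ y (rec_index_gt0 n).
have M1 : M < M + 1 by rewrite ltrDl.
move=> /(NM _ M1) yN.
have bg i : `|bgrad y a i| <= M + 1 by exact: le_trans (entry_le_norm _ _ _) yN.
(* Two corners that differ only by [e_1], hence lie on opposite sides of the gap. *)
pose i0 : 'I_8 := ord0; pose i4 : 'I_8 := Ordinal (isT : (4 < 8)%N).
have zB i b : `|(x' + z' R i) b 0| <= B + 1.
  rewrite linmxE (le_trans (ler_normD _ _))// lerD ?LB// z'_bound.
  by rewrite invf_le1// ler1n.
have := jn _ _ (zB i0) (zB i4); apply/negP; rewrite -ltNge.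
have yE i : y a i = col i y a 0 by rewrite [RHS]mxE.
have -> : (atom (rec_rate n) (rec_index n) (rec_map n) 0 (x' + z' R i0)
    - atom (rec_rate n) (rec_index n) (rec_map n) 1 (x' + z' R i4)) a 0
    = bgrad y a i0 - bgrad y a i4.
  have -> : bgrad y a i0 - bgrad y a i4 = y a i0 - y a i4.
    by rewrite [bgrad y a i0]mxE [bgrad y a i4]mxE; ring.
  by rewrite addmxE oppmxE !yE !col_cell_at.
rewrite (le_lt_trans (ler_normB _ _))//.
by have := bg i0; have := bg i4; lra.
Unshelve. all: by end_near.
Qed.

Lemma rec_limit :
  limn_esup (fun n => scaled_energy L' W (rec_rate n) (rec_index n) (rec_map n))
  = (nb 1 * omegaNN + nb 2 * omegaNNN)%:E.
Proof.
apply: limn_esup_eq => e e0.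
pose d := e / (nb 1 + nb 2 + 1).
have nb0 : (0 : R) < nb 1 + nb 2 + 1 by rewrite ltr_wpDl// addr_ge0.
have d0 : 0 < d by rewrite divr_gt0.
have [N1 far1] := far_potential hcf hNN hfarNN d0.
have [N2 far2] := far_potential hcf hNNN hfarNNN d0.
have [B B0 LB] := finite_entry_bound (finite_lattice hS).
have [a jump] := rec_jump (Num.max (N1%:R) (N2%:R * Num.sqrt 2)) B.
have chi0 := rec_chi_near.
have de : (nb 1 + nb 2) * d <= e.
  by rewrite /d mulrA ler_pdivrMr// mulrC ler_pM2l//; lra.
have finP h := finite_bond_pairs hS h.
near=> n.
have kN N : (N <= n)%N -> (N <= rec_index n)%N.
  by move=> Nn; rewrite /rec_index expnS expn1; nia.
have k1 : (N1 <= rec_index n)%N by apply: kN; near: n; exact: nbhs_infty_ge.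
have k2 : (N2 <= rec_index n)%N by apply: kN; near: n; exact: nbhs_infty_ge.
have long h p : bond_pairs S h p -> Num.max (N1%:R) (N2%:R * Num.sqrt 2)
    <= bond (rec_rate n) (rec_index n) (rec_map n) 0 p.
  move=> [Lp1 Lp2 _]; apply: (@le_trans _ _ _ _ _ _ (entry_le_enorm _ a 0)).
  have jn : forall p q : 'cV[R]_2, (forall b, `|p b 0| <= B) ->
      (forall b, `|q b 0| <= B) -> Num.max (N1%:R) (N2%:R * Num.sqrt 2)
      <= `|(atom (rec_rate n) (rec_index n) (rec_map n) 0 p
         - atom (rec_rate n) (rec_index n) (rec_map n) 1 q) a 0| by near: n.
  by rewrite add0r; apply: jn => b; exact: LB.
have f1 p : bond_pairs S 1 p -> ((omegaNN - d)%:E <= (rec_index n)%:R%:E *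
    WNN (rec_index n) (bond (rec_rate n) (rec_index n) (rec_map n) 0 p)
    <= (omegaNN + d)%:E)%E.
  by move=> /long; rewrite ge_max => /andP[/(far1 _ _ k1)].
have f2 p : bond_pairs S 2 p -> ((omegaNNN - d)%:E <= (rec_index n)%:R%:E *
    WNNN (rec_index n)
      (bond (rec_rate n) (rec_index n) (rec_map n) 0 p / Num.sqrt 2)%R
    <= (omegaNNN + d)%:E)%E.
  move=> /long; rewrite ge_max => /andP[_]; rewrite -ler_pdivlMr ?sqrtr_gt0//.
  exact: (far2 _ _ k2).
rewrite rec_energy; last by near: n.
apply/andP; split.
  apply: (@le_trans _ _ (nb 1 * (omegaNN - d) + nb 2 * (omegaNNN - d))%:E).
    by rewrite lee_fin; lra.
  rewrite EFinD -!fsume_const//; apply: leeD; apply: lee_fsum => // p.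
    by move=> /f1/andP[].
  by move=> /f2/andP[].
apply: (@le_trans _ _ (nb 1 * (omegaNN + d) + nb 2 * (omegaNNN + d))%:E); last first.
  by rewrite lee_fin; lra.
rewrite [leRHS]EFinD -!fsume_const//; apply: leeD; apply: lee_fsum => // p.
  by move=> /f1/andP[].
by move=> /f2/andP[].
Unshelve. all: by end_near.
Qed.

End Recovery.

(** * The value of the cell formula and its attainment *)

Lemma card_bond_pairs1 (R : realType) (S L' : set 'cV[R]_2) : cross_section S L' ->
  #|` fset_set (bond_pairs S 1)| = #|` fset_set (lattice S)|.
Proof.
move=> /finite_lattice finL; rewrite bond_pairs1 fset_set_image// card_imfset//.
by move=> p q [].
Qed.

Theorem proposition8p1 (R : realType) (L : R) (S L' : set 'cV[R]_2)
    (cf : nat -> R)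
    (WNN WNNN WbarNN WbarNNN : nat -> R -> \bar R) (W0NN W0NNN : R -> R)
    (chi : nat -> 'M[R]_(3, 8) -> R)
    (cfrac : nat -> R) (W0 : 'cV[R]_2 -> 'M[R]_(3, 8) -> \bar R)
    (omegaNN omegaNNN : R)
    (hL : 0 < L) (hS : cross_section S L')
    (hcf : threshold cf)
    (hNN : pair_potential cf WNN WbarNN W0NN)
    (hNNN : pair_potential cf WNNN WbarNNN W0NNN)
    (hchi : orientation_penalty chi)
    (hW : standing_assumptions L S L'
            (Wcell WNN WNNN chi) (Wsurf S WNN WNNN) (Wend L S WNN WNNN)
            cfrac W0)
    (hfarNN : far_limit WbarNN omegaNN)
    (hfarNNN : far_limit WbarNNN omegaNNN)
    (u : 'cV[R]_3) (Q : 'M[R]_3) (hu : u != 0) (hQ : SO3 Q) :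
  let W := Wtot L' (Wcell WNN WNNN chi) (Wsurf S WNN WNNN) in
  phi S L' W u Q
    = ((#|` fset_set (lattice S)|)%:R * omegaNN
       + (#|` fset_set (neighbour_pairs S)|)%:R * omegaNNN)%:E
  /\ (forall (yp ym : 'cV[R]_3) (Rp Rm : 'M[R]_3),
        SO3 Rp -> SO3 Rm -> yp - ym = u -> invmx Rm *m Rp = Q ->
        is_minimum (limit_energies S L' W yp ym Rp Rm) (phi S L' W u Q)).
Proof.
move=> W; rewrite -(card_bond_pairs1 hS) -bond_pairs2.
set C := (_%:R * omegaNN + _)%:E.
have neq (yp ym : 'cV[R]_3) : yp - ym = u -> yp != ym.
  by move=> yu; rewrite -subr_eq0 yu.
have lower (yp ym : 'cV[R]_3) (Rp Rm : 'M[R]_3) e : yp - ym = u ->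
    limit_energies S L' W yp ym Rp Rm e -> (C <= e)%E.
  move=> /neq ypm [r [k [v [ts ->]]]].
  exact: (limit_energy_ge hS hcf hNN hNNN hchi hfarNN hfarNNN ts ypm).
have attained (yp ym : 'cV[R]_3) (Rp Rm : 'M[R]_3) : SO3 Rp -> SO3 Rm ->
    yp - ym = u -> limit_energies S L' W yp ym Rp Rm C.
  move=> SORp SORm /neq ypm.
  exists (@rec_rate R), rec_index, (rec_map yp ym Rp Rm); split.
    exact: (rec_transition_sequences hS).
  apply/esym.
  exact: (rec_limit hS hcf hNN hNNN hchi hW hfarNN hfarNNN SORp SORm ypm).
(* [C] bounds the limit energies of every representation of [(u, Q)] from below and is attained in
   each, so the infimum over representations loses nothing; [(u, 0, Q, 1)] serves as a witness. *)
have phiC : phi S L' W u Q = C.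
  apply/eqP; rewrite eq_le; apply/andP; split.
    apply: ereal_inf_lbound; exists u, 0, Q, 1%:M.
    have SO1 : SO3 (1%:M : 'M[R]_3).
      by split; [rewrite /O3/= trmx1 mulmx1|rewrite det1].
    split => //; first by rewrite subr0.
      by rewrite invmx1 mul1mx.
    by apply: attained => //; rewrite subr0.
  by apply: le_ereal_inf_tmp => e [yp [ym [Rp [Rm [_ _ yu _ /(lower _ _ _ _ _ yu)]]]]].
split=> // yp ym Rp Rm SORp SORm yu _; rewrite phiC; split; first exact: attained.
by move=> e /(lower _ _ _ _ _ yu).
Qed.
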